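(* Let $g\in\mathcal{F}$, and assume that for every $L_0\in\mathbb{R}$ a minimizer $f_{L_0}$ of $\|K(g-f)\|$ subject to $Lf=L_0$ and $f\in\mathcal{F}$ exists. Then the confidence set $\mathcal{C}_g$ that minimizes $E_g\lambda(\mathcal{C})$ subject to $\mathcal{C}\in\mathcal{I}_\alpha$ inverts the family of tests $\phi_{L_0}$, $L_0\in\mathbb{R}$, where $\phi_{L_0}$ rejects for large values of $\langle K(g-f_{L_0}),Y\rangle$ with critical value given by its $1-\alpha$ quantile under $f_{L_0}$. Its expected length under $g$ is $$E_g[\lambda(\mathcal{C}_g)]=(1-\alpha)\,E\left[\omega(\sigma(z_{1-\alpha}-Z);\mathcal{F},\{g\})+\omega(\sigma(z_{1-\alpha}-Z);\{g\},\mathcal{F})\,\middle|\,Z\le z_{1-\alpha}\right],$$ where $Z$ is a standard normal random variable.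
   Context: Model: one observes $Y=Kf+\sigma\varepsilon$, where $f$ is known to lie in a convex subset $\mathcal{F}$ of a vector space, $K$ is a known linear operator from (the span of) $\mathcal{F}$ to a real Hilbert space $\mathcal{Y}$ with inner product $\langle\cdot,\cdot\rangle$ and norm $\|\cdot\|$, $\sigma>0$ is known, and $\varepsilon$ is standard Gaussian: for each $h\in\mathcal{Y}$, $\langle\varepsilon,h\rangle\sim\mathcal{N}(0,\|h\|^2)$. $L$ is a linear functional; the parameter of interest is $Lf$. $P_f,E_f$ denote probability and expectation under $f$; $\alpha\in(0,1)$; $z_{q}$ is the $q$-quantile of the standard normal distribution; $\lambda$ is Lebesgue measure on $\mathbb{R}$. $\mathcal{I}_\alpha$ is the collection of $1-\alpha$ confidence sets: (random) sets $\mathcal{C}=\mathcal{C}(Y)\subseteq\mathbb{R}$ with $\inf_{f\in\mathcal{F}}P_f(Lf\in\mathcal{C})\ge1-\alpha$ (not required to be intervals). The confidence set that inverts a family of tests $\phi_{L_0}$ is the set of $L_0\in\mathbb{R}$ not rejected by $\phi_{L_0}$. Ordered modulus of continuity, for sets $\mathcal{A},\mathcal{B}$: $\omega(\delta;\mathcal{A},\mathcal{B})=\sup\{Lb-La:\|K(b-a)\|\le\delta,\ a\in\mathcal{A},\ b\in\mathcal{B}\}$.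
   Formalization: Inversion holds almost surely for each L_0; where K f_{L_0} = K g the statistic is constant and the test may break the tie by any rule (never rejecting there can be suboptimal); that every minimizer inverts the tests is claimed for a.e. L_0 and only if the minimal expected length is finite. *)

(* Defs.v *)
From HB Require Import structures.
From mathcomp Require Import all_boot all_order all_algebra.
From mathcomp Require Import sesquilinear.
From mathcomp Require Import all_classical all_reals all_analysis.

Set Implicit Arguments.
Unset Strict Implicit.
Unset Printing Implicit Defensive.

Import Order.TTheory GRing.Theory Num.Theory.
Import numFieldNormedType.Exports.

Local Open Scope classical_set_scope.
Local Open Scope ring_scope.

(* The library's [normal_prob m 0] is a junk value (the uniform law on [0, 1]);
   N(m, 0) has to be the Dirac mass at m. The argument s is the standard
   deviation. *)
Definition is_normal d (T : measurableType d) (R : realType)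
    (P : probability T R) (X : {RV P >-> R}) (m s : R) : Prop :=
  forall B : set R, measurable B ->
    distribution P X B = (if s == 0 then \d_m B else normal_prob m s B).

Definition quantile (R : realType) (mu : set R -> \bar R) (q : R) : R :=
  inf [set x : R | (q%:E <= mu `]-oo, x]%classic)%E].

Definition normal_quantile (R : realType) (q : R) : R :=
  quantile (normal_prob 0 1) q.

Definition cond_expectation d (T : measurableType d) (R : realType)
    (P : probability T R) (X : T -> \bar R) (A : set T) : \bar R :=
  (\int[P]_(w in A) X w * ((fine (P A))^-1)%:E)%E.

(* In infinite dimension a Gaussian white noise is not an element of H: it is
   the random family of its "inner products" eps h, written <eps, h>. Linearity
   in h holds almost surely, the null set depending on a, h and k. *)
Definition standard_gaussian d (T : measurableType d) (R : realType)
    (P : probability T R) (H : normedModType R) (eps : H -> {RV P >-> R})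
    : Prop :=
  (forall (a : R) (h k : H),
     {ae P, forall w, eps (a *: h + k) w = a * eps h w + eps k w}) /\
  (forall h : H, is_normal (eps h) 0 `|h|).

(* Accordingly, an observation is the family y h = <Y, h>, and what can be
   computed from the data is what is measurable for the sigma-algebra generated
   by the coordinates y |-> y h. *)
Definition cylinder (H : Type) (R : realType) : set (set (H -> R)) :=
  [set A | exists (h : H) (B : set R),
     measurable B /\ A = (fun y : H -> R => y h) @^-1` B].

Definition obs_space (H : Type) (R : realType) :=
  g_sigma_algebraType (@cylinder H R).

(* Y = K f + sigma eps *)
Definition observation d (T : measurableType d) (R : realType)
    (P : probability T R) (V : lmodType R) (H : normedModType R)
    (ip : {dot H for idfun}) (K : {linear V -> H}) (sigma : R)
    (eps : H -> {RV P >-> R}) (f : V) (w : T) : obs_space H R :=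
  fun h => ip (K f) h + sigma * eps h w.

(* In the next definitions Y f is the observation when the parameter is f, so
   that P_f(Y \in A) is P [set w | A (Y f w)]. *)

Definition coverage d (T : measurableType d) (R : realType)
    (P : probability T R) (V : lmodType R) (H : Type)
    (Y : V -> T -> obs_space H R) (C : obs_space H R -> set R) (f : V) (l : R)
    : \bar R :=
  P [set w | C (Y f w) l].

(* The collection I_alpha. Joint measurability is what makes C a random set
   with a measurable length. *)
Definition confidence_set d (T : measurableType d) (R : realType)
    (P : probability T R) (V : lmodType R) (H : Type)
    (Y : V -> T -> obs_space H R) (F : set V) (L : {scalar V}) (alpha : R)
    (C : obs_space H R -> set R) : Prop :=
  measurable [set yl : obs_space H R * R | C yl.1 yl.2] /\
  ((1 - alpha)%:E <= ereal_inf [set coverage P Y C f (L f) | f in F])%E.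

Definition expected_length d (T : measurableType d) (R : realType)
    (P : probability T R) (V : lmodType R) (H : Type)
    (Y : V -> T -> obs_space H R) (g : V) (C : obs_space H R -> set R)
    : \bar R :=
  (\int[P]_w lebesgue_measure (C (Y g w)))%E.

Definition minimizes_expected_length d (T : measurableType d) (R : realType)
    (P : probability T R) (V : lmodType R) (H : Type)
    (Y : V -> T -> obs_space H R) (F : set V) (L : {scalar V}) (alpha : R)
    (g : V) (C : obs_space H R -> set R) : Prop :=
  confidence_set P Y F L alpha C /\
  forall C' : obs_space H R -> set R, confidence_set P Y F L alpha C' ->
    (expected_length P Y g C <= expected_length P Y g C')%E.

Definition is_constrained_minimizer (R : realType) (V : lmodType R)
    (H : normedModType R) (F : set V) (K : {linear V -> H}) (L : {scalar V})
    (g : V) (l : R) (f : V) : Prop :=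
  [/\ F f, L f = l &
      forall f', F f' -> L f' = l -> `|K (g - f)| <= `|K (g - f')|].

Definition test_statistic (R : realType) (V : lmodType R) (H : normedModType R)
    (K : {linear V -> H}) (g f0 : V) (y : obs_space H R) : R :=
  y (K (g - f0)).

Definition critical_value d (T : measurableType d) (R : realType)
    (P : probability T R) (V : lmodType R) (H : normedModType R)
    (Y : V -> T -> obs_space H R) (K : {linear V -> H}) (alpha : R) (g f0 : V)
    : R :=
  quantile (pushforward P (fun w => test_statistic K g f0 (Y f0 w)))
    (1 - alpha).

(* Up to null events of the model, l is excluded from C when the statistic
   exceeds the critical value and kept when it is below. A tie has probability
   zero unless K f0 = K g; in that case the statistic and the critical value
   are both 0, and the test is any rule for breaking the tie. *)
Definition inverts_test_at d (T : measurableType d) (R : realType)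
    (P : probability T R) (V : lmodType R) (H : normedModType R)
    (Y : V -> T -> obs_space H R) (F : set V) (K : {linear V -> H}) (alpha : R)
    (g f0 : V) (C : obs_space H R -> set R) (l : R) : Prop :=
  let c := critical_value P Y K alpha g f0 in
  forall f, F f -> {ae P, forall w,
    (c < test_statistic K g f0 (Y f w) -> ~ C (Y f w) l) /\
    (test_statistic K g f0 (Y f w) < c -> C (Y f w) l)}.

Definition modulus (R : realType) (V : lmodType R) (H : normedModType R)
    (K : {linear V -> H}) (L : {scalar V}) (delta : R) (A B : set V)
    : \bar R :=
  ereal_sup [set x | exists a b,
    [/\ A a, B b, `|K (b - a)| <= delta & x = (L b - L a)%:E]].

(* Main.v *)
(* For each l write k_l = K(g - f_l), where f_l minimizes |K(g - f)| over the f
   in F with L f = l. By Tonelli, the expected length under g of a random set C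
   is the integral over l of P_g(l \in C), and since C covers l under f_l with
   probability at least 1 - alpha, the Neyman-Pearson lemma for f_l against g
   bounds P_g(l \in C) below by Phi(z - |k_l| / sigma). The bound is attained by
   the tests based on <k_l, Y>, which are valid for every f in F with L f = l
   because K f_l is the projection of K g on a convex set. A second use of
   Tonelli turns the integral of Phi(z - |k_l| / sigma) into the expectation of
   the length of the interval {l | |k_l| <= sigma (z - Z)}, which is the sum of
   the two moduli.

   The white noise is only a family of scalar Gaussian variables. Two processes
   that are almost surely linear in h and have the same one-dimensional laws have
   the same law on the observation space; hence, for a unit vector u, the noise
   is distributed as x <., u> plus its part orthogonal to u, with x standard
   normal and independent. This reduces shifts of the mean along u to the real
   line, where the likelihood ratio is explicit.

   Where k_l = 0 the test is degenerate and its level has to be reached by a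
   randomization: if k_m is not 0 for some m, the event that <k_m, Y> is far from
   its mean under g does this for all l at once, by Anderson's inequality; if all
   k_m are 0, every confidence set has infinite expected length.

   <k_l, Y> is jointly measurable in (l, Y) only up to null sets, so the optimal
   set is built from dyadic approximations of l, along which <k_l, Y> converges
   almost surely because |k_s - k_l|^2 = O(|s - l|). *)

Require Import Defs.
From HB Require Import structures.
From mathcomp Require Import all_boot all_order all_algebra.
From mathcomp Require Import sesquilinear.
From mathcomp Require Import all_classical all_reals all_analysis.
From mathcomp Require Import measurable_realfun.
From mathcomp Require Import ring lra.

Set Implicit Arguments.
Unset Strict Implicit.
Unset Printing Implicit Defensive.

Import Order.TTheory GRing.Theory Num.Theory.
Import numFieldNormedType.Exports.

Local Open Scope classical_set_scope.
Local Open Scope ring_scope.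

(** * Measures of events that are almost surely comparable *)

Lemma ae_le_measure d (T : measurableType d) (R : realType)
    (P : {measure set T -> \bar R}) (A B : set T) :
  measurable A -> measurable B -> {ae P, forall w, A w -> B w} ->
  (P A <= P B)%E.
Proof.
move=> mA mB [N [mN N0 sub]].
rewrite (@le_trans _ _ (P (B `|` N)))//.
  apply: le_measure; rewrite ?inE//; first exact: measurableU.
  move=> w Aw; apply: contrapT => /not_orP[Bw Nw]; apply: Nw; apply: sub.
  by move=> AB; exact: (Bw (AB Aw)).
have N0' : (P N <= 0)%E by rewrite N0.
apply: (le_trans (measureU2 _ mB mN)).
by rewrite -[leRHS]adde0; apply: leeD2l; exact: N0'.
Qed.

Lemma ae_eq_measure d (T : measurableType d) (R : realType)
    (P : {measure set T -> \bar R}) (A B : set T) :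
  measurable A -> measurable B -> {ae P, forall w, A w <-> B w} -> P A = P B.
Proof.
move=> mA mB AB; apply/eqP; rewrite eq_le; apply/andP; split.
- by apply: ae_le_measure => //; apply: filterS AB => w [].
- by apply: ae_le_measure => //; apply: filterS AB => w [].
Qed.

Lemma measurable_preimage d d' (T : measurableType d) (T' : measurableType d')
    (f : T -> T') (A : set T') : measurable_fun setT f -> measurable A ->
  measurable [set w | A (f w)].
Proof. by move=> mf mA; rewrite -[X in measurable X]setTI; exact: mf. Qed.

(** * Measurability into the observation space *)

Section observation_space.
Context (R : realType) (H : Type).
Local Notation obs := (obs_space H R).

Lemma measurable_coordinate (h : H) :
  measurable_fun setT (fun y : obs => y h).
Proof.
move=> _ B mB; rewrite setTI; apply: sub_sigma_algebra.
by exists h, B.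
Qed.

Lemma measurable_into_obs d (T : measurableType d) (X : H -> T -> R) :
  (forall h, measurable_fun setT (X h)) ->
  measurable_fun setT (fun w => (fun h => X h w) : obs).
Proof.
move=> mX.
apply: (@measurability _ _ T obs setT (fun w h => X h w) (@cylinder H R) erefl).
move=> _ [_ [h [B [mB ->]]] <-].
exact: (mX h).
Qed.
End observation_space.

(** * Bounded measurable functions and bounded convergence *)

Section bounded_measurable.
Context (R : realType) d (T : measurableType d).

Definition bounded_measurable (f : T -> R) :=
  measurable_fun setT f /\ exists M, forall y, `|f y| <= M.
Local Notation bm := bounded_measurable.

Lemma bounded_measurable_cst c : bm (fun=> c).
Proof. by split; [exact: measurable_cst|exists `|c|]. Qed.

Lemma bounded_measurableD f g : bm f -> bm g -> bm (fun y => f y + g y).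
Proof.
move=> [mf [a fa]] [mg [b gb]]; split; first exact: measurable_funD.
by exists (a + b) => y; rewrite (le_trans (ler_normD _ _))// lerD.
Qed.

Lemma bounded_measurableM f g : bm f -> bm g -> bm (fun y => f y * g y).
Proof.
move=> [mf [a fa]] [mg [b gb]]; split; first exact: measurable_funM.
by exists (a * b) => y; rewrite normrM ler_pM.
Qed.

Lemma bounded_measurable_integrable (P : probability T R) f : bm f ->
  P.-integrable setT (EFin \o f).
Proof.
move=> [mf [M fM]]; apply: measurable_bounded_integrable => //.
  by rewrite (le_lt_trans (probability_le1 _ _)) ?ltry.
exists M; split; first exact: num_real.
by move=> x Mx y _; exact: le_trans (fM y) (ltW Mx).
Qed.

Lemma bounded_cvg (f : nat -> T -> R) g M :
  (forall n, measurable_fun setT (f n)) -> (forall n y, `|f n y| <= M) ->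
  (forall y, f ^~ y @ \oo --> g y) -> bm g.
Proof.
move=> mf fM fg; split.
  by apply: (@measurable_fun_cvg _ _ _ setT f) => // y _; exact: fg.
exists M => y; apply: (cvgr_to_le (cvg_norm (fg y))).
by near=> n; exact: fM.
Unshelve. all: by end_near. Qed.

Lemma bounded_cvg_integral (P : probability T R) (f : nat -> T -> R) g M :
  (forall n, measurable_fun setT (f n)) -> (forall n y, `|f n y| <= M) ->
  (forall y, f ^~ y @ \oo --> g y) ->
  (fun n => \int[P]_y f n y) @ \oo --> \int[P]_y g y.
Proof.
move=> mf fM fg.
have bg := bounded_cvg mf fM fg.
have [] := @dominated_convergence _ T R P setT measurableT
  (fun n => EFin \o f n) (EFin \o g) (fun=> M%:E).
- by move=> n; exact/measurable_EFinP.
- by apply/measurable_EFinP; case: bg.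
- apply: aeW => y _; apply: cvg_EFin; last exact: fg.
  by near=> n.
- exact: (bounded_measurable_integrable P (bounded_measurable_cst M)).
- by apply: aeW => y n _; rewrite /= lee_fin.
move=> _ _ H; apply: fine_cvg.
rewrite fineK; last by apply: integrable_fin_num => //; exact: bounded_measurable_integrable.
exact: H.
Unshelve. all: by end_near. Qed.

End bounded_measurable.

(** * Approximation of the sign by polynomials in sines *)

Section sign_approximation.
Context (R : realType).
Implicit Types u x a : R.

(* On [-1, 1] the iterates converge to the sign. Applied to sines, they lead from
   trigonometric polynomials to indicators of half-lines. *)
Definition sign_step u := (3 * u - u ^+ 3) / 2.
Definition sign_iter n u := iter n sign_step u.

Lemma sign_iterN n u : sign_iter n (- u) = - sign_iter n u.
Proof. by elim: n => //= n ->; rewrite /sign_step; ring. Qed.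

Lemma sign_iter0 n : sign_iter n 0 = 0.
Proof. by elim: n => //= n ->; rewrite /sign_step; ring. Qed.

(** With [v] the current iterate, [1 - sign_step v = (1 - v) * ((1 - v) * (1 + v / 2))], and the
    factor multiplying [1 - v] is at most [1 - v / 2 <= 1 - u / 2], because the iterates never drop
    below [u]. *)
Lemma sign_iter_itv n u : 0 < u <= 1 ->
  u <= sign_iter n u <= 1 /\ 1 - sign_iter n u <= (1 - u / 2) ^+ n.
Proof.
move=> /andP[u0 u1]; elim: n => [|n [/andP[un n1] IH]] /=.
  rewrite lexx u1 expr0; split => //; lra.
set v := sign_iter n u in un n1 IH *; rewrite /sign_step.
have E : 1 - (3 * v - v ^+ 3) / 2 = (1 - v) * ((1 - v) * (1 + v / 2)) by field.
have h1 : (1 - v) * (1 + v / 2) <= 1 - u / 2 by nra.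
have h0 : 0 <= (1 - v) * (1 + v / 2) by nra.
split; first by apply/andP; split; nra.
by rewrite E exprSr ler_pM// subr_ge0.
Qed.

Lemma sign_iter_norm n u : `|u| <= 1 -> `|sign_iter n u| <= 1.
Proof.
have [u0|u0|->] := ltgtP u 0; last by rewrite sign_iter0.
- rewrite -[u]opprK sign_iterN !normrN ltr0_norm// => u1.
  have [] := @sign_iter_itv n (- u); first by rewrite oppr_gt0 u0.
  by move=> /andP[h1 h2] _; rewrite ger0_norm// (le_trans _ h1)// oppr_ge0 ltW.
- rewrite gtr0_norm// => u1; have [] := @sign_iter_itv n u; first by rewrite u0.
  by move=> /andP[h1 h2] _; rewrite ger0_norm// (le_trans _ h1)// ltW.
Qed.

Lemma cvg_sign_iter u : `|u| <= 1 -> sign_iter ^~ u @ \oo --> Num.sg u.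
Proof.
have pos v : 0 < v <= 1 -> sign_iter ^~ v @ \oo --> (1 : R).
  move=> v01; have /andP[v0 v1] := v01.
  apply: (@squeeze_cvgr _ _ _ _ (fun n => 1 - (1 - v / 2) ^+ n) (fun=> 1)).
  - near=> n; have [/andP[_ ->] h] := sign_iter_itv n v01.
    by rewrite andbT lerBlDl -lerBlDr.
  - rewrite -[X in _ --> X]subr0; apply: cvgB; first exact: cvg_cst.
    have v2 : `|1 - v / 2| < 1 by rewrite ger0_norm; lra.
    exact: cvg_expr v2.
  - exact: cvg_cst.
have [u0|u0|->] := ltgtP u 0.
- rewrite ltr0_norm// => u1; rewrite ltr0_sg// -[u]opprK.
  under eq_fun do rewrite sign_iterN.
  by apply: cvgN; apply: pos; rewrite oppr_gt0 u0.
- by rewrite gtr0_norm// => u1; rewrite gtr0_sg//; apply: pos; rewrite u0.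
- by move=> _; rewrite sgr0; under eq_fun do rewrite sign_iter0; exact: cvg_cst.
Unshelve. all: by end_near. Qed.

(** Once [n.+1%:R * pi] exceeds the absolute value of [x], the argument lies strictly between [- pi]
    and [pi], where the sine has the sign of its argument: the sequence is eventually constant. *)
Lemma cvg_sg_sin x :
  (fun n : nat => Num.sg (sin (x / n.+1%:R))) @ \oo --> Num.sg x.
Proof.
have pos v : 0 < v -> v < pi -> Num.sg (sin v) = Num.sg v.
  move=> v0 vpi; have s0 : 0 < sin v by apply: sin_gt0_pi; rewrite v0.
  by rewrite (gtr0_sg v0) (gtr0_sg s0).
have sgsin v : `|v| < pi -> Num.sg (sin v) = Num.sg v.
  have [v0|v0|->] := ltgtP v 0; last by rewrite sin0.
  - rewrite ltr0_norm// => vpi; have nv0 : 0 < - v by rewrite oppr_gt0.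
    by rewrite -[v]opprK sinN [LHS]sgrN [RHS]sgrN pos.
  - by rewrite gtr0_norm//; exact: pos.
apply: cvg_near_cst; near=> n.
have n0 : (0 : R) < n.+1%:R by [].
apply/eqP; rewrite sgsin.
  by rewrite sgrM (gtr0_sg (x := _^-1)) ?invr_gt0 ?mulr1.
rewrite normrM normfV (gtr0_norm n0) ltr_pdivrMr// -ltr_pdivrMl ?pi_gt0//.
rewrite (@lt_le_trans _ _ n%:R) ?ler_nat//.
by near: n; exact: nbhs_infty_gtr.
Unshelve. all: by end_near. Qed.

End sign_approximation.

Lemma measurable_cos (R : realType) : measurable_fun [set: R] (@cos R).
Proof. by apply: continuous_measurable_fun; exact: continuous_cos. Qed.

Lemma measurable_sin (R : realType) : measurable_fun [set: R] (@sin R).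
Proof. by apply: continuous_measurable_fun; exact: continuous_sin. Qed.

(** * Processes that are almost surely linear *)

Section ae_linear.
Context (R : realType) (H : lmodType R) d (T : measurableType d)
  (P : probability T R) (X : H -> T -> R).
Hypothesis linX : forall a h k,
  {ae P, forall w, X (a *: h + k) w = a * X h w + X k w}.

Lemma ae_zero : {ae P, forall w, X 0 w = 0}.
Proof.
apply: filterS (linX 1 0 0) => w; rewrite scaler0 addr0 mul1r => e.
by apply: (addrI (X 0 w)); rewrite -e addr0.
Qed.

Lemma ae_scalar a k : {ae P, forall w, X (a *: k) w = a * X k w}.
Proof.
by apply: filterS2 ae_zero (linX a k 0) => w X0; rewrite addr0 X0 addr0.
Qed.

End ae_linear.

(** * Uniqueness of the law given the one-dimensional marginals *)

Section law_unique.
Context (R : realType) (H : lmodType R).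
Local Notation obs := (obs_space H R).
Local Notation bm := (@bounded_measurable R _ _).

Context d1 (T1 : measurableType d1) (P1 : probability T1 R) (X1 : H -> T1 -> R).
Context d2 (T2 : measurableType d2) (P2 : probability T2 R) (X2 : H -> T2 -> R).
Hypothesis mX1 : forall h, measurable_fun setT (X1 h).
Hypothesis mX2 : forall h, measurable_fun setT (X2 h).
Hypothesis linX1 : forall a h k,
  {ae P1, forall w, X1 (a *: h + k) w = a * X1 h w + X1 k w}.
Hypothesis linX2 : forall a h k,
  {ae P2, forall w, X2 (a *: h + k) w = a * X2 h w + X2 k w}.
Hypothesis marginals : forall h B, measurable B ->
  P1 (X1 h @^-1` B) = P2 (X2 h @^-1` B).

Let Y1 w : obs := fun h => X1 h w.
Let Y2 w : obs := fun h => X2 h w.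

Let wave (h : H) (c : R) : obs -> R := fun y => cos (y h + c).

Let E1 (f : obs -> R) := \int[P1]_w f (Y1 w).
Let E2 (f : obs -> R) := \int[P2]_w f (Y2 w).

Let bm1 f : bm f -> bm (f \o Y1).
Proof.
move=> [mf [M fM]]; split; last by exists M => y; exact: fM.
by apply: measurableT_comp => //; exact: measurable_into_obs.
Qed.

Let bm2 f : bm f -> bm (f \o Y2).
Proof.
move=> [mf [M fM]]; split; last by exists M => y; exact: fM.
by apply: measurableT_comp => //; exact: measurable_into_obs.
Qed.

Let bm_wave h c : bm (wave h c).
Proof.
split; last by exists 1 => y; exact: cos_max.
apply: measurableT_comp; first exact: measurable_cos.
by apply: measurable_funD => //; exact: measurable_coordinate.
Qed.

(* The multipliers that preserve the test functions are closed under sums,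
   products and bounded pointwise limits, so the sets whose indicator is a
   multiplier form a sigma-algebra. *)
Let test (f : obs -> R) :=
  bm f /\ forall h c, E1 (fun y => f y * wave h c y) = E2 (fun y => f y * wave h c y).

Let mult (u : obs -> R) := bm u /\ forall f, test f -> test (fun y => u y * f y).

Let E1D f g : bm f -> bm g -> E1 (fun y => f y + g y) = E1 f + E1 g.
Proof.
by move=> bf bg; rewrite /E1 RintegralD//;
  [exact: bounded_measurable_integrable (bm1 bf)|exact: bounded_measurable_integrable (bm1 bg)].
Qed.

Let E2D f g : bm f -> bm g -> E2 (fun y => f y + g y) = E2 f + E2 g.
Proof.
by move=> bf bg; rewrite /E2 RintegralD//;
  [exact: (bounded_measurable_integrable _ (bm2 bf))|exact: (bounded_measurable_integrable _ (bm2 bg))].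
Qed.

Let E1Z a f : bm f -> E1 (fun y => a * f y) = a * E1 f.
Proof. by move=> bf; rewrite /E1 RintegralZl//; exact: (bounded_measurable_integrable _ (bm1 bf)). Qed.

Let E2Z a f : bm f -> E2 (fun y => a * f y) = a * E2 f.
Proof. by move=> bf; rewrite /E2 RintegralZl//; exact: (bounded_measurable_integrable _ (bm2 bf)). Qed.

Let E1ae f g : bm f -> bm g -> {ae P1, forall w, f (Y1 w) = g (Y1 w)} -> E1 f = E1 g.
Proof.
move=> bf bg fg; rewrite /E1 /Rintegral; congr fine; apply: ae_eq_integral => //.
- by apply/measurable_EFinP; case: (bm1 bf).
- by apply/measurable_EFinP; case: (bm1 bg).
- by apply: filterS fg => w /= -> _.
Qed.

Let E2ae f g : bm f -> bm g -> {ae P2, forall w, f (Y2 w) = g (Y2 w)} -> E2 f = E2 g.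
Proof.
move=> bf bg fg; rewrite /E2 /Rintegral; congr fine; apply: ae_eq_integral => //.
- by apply/measurable_EFinP; case: (bm2 bf).
- by apply/measurable_EFinP; case: (bm2 bg).
- by apply: filterS fg => w /= -> _.
Qed.

(** The hypothesis on marginals enters here: against the constant 1 the integrand depends on the
    single coordinate [y h]. Multipliers then carry the equality to functions of several
    coordinates. *)
Let test1 : test (fun=> 1).
Proof.
split=> [|h c]; first exact: bounded_measurable_cst.
rewrite /E1 /E2 /Rintegral; congr fine.
pose phi (x : R) := (1 * cos (x + c))%:E.
have mphi : measurable_fun setT phi.
  apply/measurable_EFinP; apply: measurable_funM => //.
  apply: measurableT_comp; first exact: measurable_cos.
  exact: measurable_funD.
have b1 : bm (fun w => 1 * wave h c (Y1 w)) by apply: bounded_measurableM; [exact: bounded_measurable_cst|exact: (bm1 (bm_wave h c))].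
have b2 : bm (fun w => 1 * wave h c (Y2 w)) by apply: bounded_measurableM; [exact: bounded_measurable_cst|exact: (bm2 (bm_wave h c))].
have := @integral_pushforward _ _ _ _ _ _ (mX1 h) P1 setT phi mphi (bounded_measurable_integrable _ b1) measurableT.
rewrite preimage_setT => <-.
have := @integral_pushforward _ _ _ _ _ _ (mX2 h) P2 setT phi mphi (bounded_measurable_integrable _ b2) measurableT.
rewrite preimage_setT => <-.
by apply: eq_measure_integral => B mB _; exact: marginals.
Qed.

Let testD f g : test f -> test g -> test (fun y => f y + g y).
Proof.
move=> [bf tf] [bg tg]; split=> [|h c]; first exact: bounded_measurableD.
under [X in E1 X]eq_fun do rewrite mulrDl.
under [X in E2 X]eq_fun do rewrite mulrDl.
by rewrite E1D ?E2D ?tf ?tg//; apply: bounded_measurableM.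
Qed.

Let testZ a f : test f -> test (fun y => a * f y).
Proof.
move=> [bf tf]; split=> [|h c]; first by apply: bounded_measurableM => //; exact: bounded_measurable_cst.
under [X in E1 X]eq_fun do rewrite -mulrA.
under [X in E2 X]eq_fun do rewrite -mulrA.
by rewrite E1Z ?E2Z ?tf//; apply: bounded_measurableM.
Qed.

Let mult_cst a : mult (fun=> a).
Proof. by split=> [|f tf]; [exact: bounded_measurable_cst|exact: testZ]. Qed.

Let multD u v : mult u -> mult v -> mult (fun y => u y + v y).
Proof.
move=> [bu tu] [bv tv]; split=> [|f tf]; first exact: bounded_measurableD.
under eq_fun do rewrite mulrDl.
by apply: testD; [exact: tu|exact: tv].
Qed.

Let multM u v : mult u -> mult v -> mult (fun y => u y * v y).
Proof.
move=> [bu tu] [bv tv]; split=> [|f tf]; first exact: bounded_measurableM.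
under eq_fun do rewrite -mulrA.
by apply: tu; exact: tv.
Qed.

Let multX u n : mult u -> mult (fun y => u y ^+ n).
Proof.
move=> mu; elim: n => [|n IH].
  by under eq_fun do rewrite expr0; exact: mult_cst.
by under eq_fun do rewrite exprS; exact: multM.
Qed.

(** Points of the observation space are arbitrary functions on [H], not linear ones, so an identity
    such as [y (a *: k) = a * y k] is available only almost surely under each of the two laws. *)
Let mult_ae u v : bm v -> mult u -> {ae P1, forall w, u (Y1 w) = v (Y1 w)} ->
  {ae P2, forall w, u (Y2 w) = v (Y2 w)} -> mult v.
Proof.
move=> bv [bu tu] uv1 uv2; split=> // f tf.
have [bf _] := tf; have [_ tuf] := tu f tf.
split=> [|h c]; first exact: bounded_measurableM.
have b1 : bm (fun y => u y * f y * wave h c y) by apply: bounded_measurableM => //; exact: bounded_measurableM.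
have b2 : bm (fun y => v y * f y * wave h c y) by apply: bounded_measurableM => //; exact: bounded_measurableM.
rewrite -(E1ae b1 b2); last by apply: filterS uv1 => w ->.
rewrite -(E2ae b1 b2); last by apply: filterS uv2 => w ->.
exact: tuf.
Qed.

Let mult_cvg (u : nat -> obs -> R) v M : (forall n, mult (u n)) ->
  (forall n y, `|u n y| <= M) -> (forall y, u ^~ y @ \oo --> v y) -> mult v.
Proof.
move=> tu uM uv.
have mu n : measurable_fun setT (u n) by have [[]] := tu n.
split=> [|f tf]; first exact: bounded_cvg uM uv.
have bv : bm v by exact: bounded_cvg uM uv.
have [bf _] := tf.
split=> [|h c]; first exact: bounded_measurableM.
have bfw : bm (fun y => f y * wave h c y) by exact: bounded_measurableM.
have [_ [N fN]] := bfw.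
pose F n y := u n y * f y * wave h c y.
have bF n : bm (F n) by have [bu _] := tu n; apply: bounded_measurableM => //; exact: bounded_measurableM.
have FM n y : `|F n y| <= M * N by rewrite /F -mulrA normrM ler_pM.
have Fcvg y : F ^~ y @ \oo --> v y * f y * wave h c y.
  by apply: cvgMl; apply: cvgMl; exact: uv.
have c1 := @bounded_cvg_integral R _ T1 P1 (fun n w => F n (Y1 w))
  (fun w => v (Y1 w) * f (Y1 w) * wave h c (Y1 w)) (M * N)
  (fun n => proj1 (bm1 (bF n))) (fun n w => FM n (Y1 w)) (fun w => Fcvg (Y1 w)).
have c2 := @bounded_cvg_integral R _ T2 P2 (fun n w => F n (Y2 w))
  (fun w => v (Y2 w) * f (Y2 w) * wave h c (Y2 w)) (M * N)
  (fun n => proj1 (bm2 (bF n))) (fun n w => FM n (Y2 w)) (fun w => Fcvg (Y2 w)).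
have e : (fun n => \int[P1]_w F n (Y1 w)) = (fun n => \int[P2]_w F n (Y2 w)).
  by apply/funext => n; have [_ /(_ f tf)[_ /(_ h c)]] := tu n.
rewrite e in c1.
exact: (cvg_unique _ c1 c2).
Qed.

(* The product formula turns a product of two waves into a sum of waves at
   [y h + y k] and [y h - y k]; almost surely these are [y (h + k)] and
   [y (h - k)]. *)
Let mult_wave k c : mult (wave k c).
Proof.
split=> // f [bf tf]; split=> [|h c']; first exact: bounded_measurableM.
pose G y := 2^-1 * (f y * wave (1 *: h + k) (c' + c) y) +
            2^-1 * (f y * wave (-1 *: k + h) (c' - c) y).
have bw : bm (fun y => wave k c y * f y * wave h c' y) by apply: bounded_measurableM => //; exact: bounded_measurableM.
have bZ h' c'' : bm (fun y => f y * wave h' c'' y) by exact: bounded_measurableM.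
have bZ2 h' c'' : bm (fun y => 2^-1 * (f y * wave h' c'' y)).
  by apply: bounded_measurableM => //; exact: bounded_measurable_cst.
have bG : bm G by exact: bounded_measurableD.
have GE (y : obs) : y (1 *: h + k) = 1 * y h + y k ->
    y (-1 *: k + h) = -1 * y k + y h ->
    wave k c y * f y * wave h c' y = G y.
  move=> e1 e2; rewrite /G /wave e1 e2.
  rewrite (_ : 1 * y h + y k + (c' + c) = (y h + c') + (y k + c)); last by ring.
  rewrite (_ : -1 * y k + y h + (c' - c) = (y h + c') - (y k + c)); last by ring.
  move: (y h + c') (y k + c) (f y) => A B D.
  by rewrite cosB cosD; field.
rewrite (E1ae bw bG); last first.
  by apply: filterS2 (linX1 1 h k) (linX1 (-1) k h) => w; exact: GE.
rewrite (E2ae bw bG); last first.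
  by apply: filterS2 (linX2 1 h k) (linX2 (-1) k h) => w; exact: GE.
by rewrite E1D// E2D// !E1Z// !E2Z// !tf.
Qed.

(** Up to null sets this is a wave at the vector [n.+1%:R^-1 *: k]; the phase [- pi / 2] turns the
    cosine into a sine. *)
Let mult_sin k a (n : nat) : mult (fun y => sin ((y k - a) / n.+1%:R)).
Proof.
have E (x y : R) : y = n.+1%:R^-1 * x ->
    cos (y + (- (a / n.+1%:R) - pi / 2)) = sin ((x - a) / n.+1%:R).
  by move=> ->; rewrite addrA cosB cos_pihalf sin_pihalf mulr0 add0r mulr1; congr sin; ring.
apply: (@mult_ae (wave (n.+1%:R^-1 *: k) (- (a / n.+1%:R) - pi / 2))).
- split; last by exists 1 => y; exact: sin_max.
  apply: measurableT_comp; first exact: measurable_sin.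
  apply: measurable_funM => //; apply: measurable_funB => //.
  exact: measurable_coordinate.
- exact: mult_wave.
- by apply: filterS (ae_scalar linX1 n.+1%:R^-1 k) => w; exact: E.
- by apply: filterS (ae_scalar linX2 n.+1%:R^-1 k) => w; exact: E.
Qed.

Let mult_sign_iter u m : mult u -> mult (fun y => sign_iter m (u y)).
Proof.
move=> mu; elim: m => [//|m IH] /=.
rewrite [X in mult X](_ : _ = fun y =>
  3 / 2 * sign_iter m (u y) + (- 2^-1) * sign_iter m (u y) ^+ 3); last first.
  by apply/funext => y; rewrite /sign_step -/(sign_iter m (u y)); field.
by apply: multD; apply: multM => //; [exact: mult_cst..|exact: multX].
Qed.

Let norm_sg (x : R) : `|Num.sg x| <= 1.
Proof. by rewrite normr_sg lern1 leq_b1. Qed.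

(** Two successive limits: in [m] the iterates turn the sine into its sign, then in [n] the sign of
    the sine becomes that of [y k - a]. *)
Let mult_sg k a : mult (fun y => Num.sg (y k - a)).
Proof.
apply: (@mult_cvg (fun n y => Num.sg (sin ((y k - a) / n.+1%:R))) _ 1) => [n|n y|y].
- apply: (@mult_cvg (fun m y => sign_iter m (sin ((y k - a) / n.+1%:R))) _ 1) => [m|m y|y].
  + by apply: mult_sign_iter; exact: mult_sin.
  + by apply: sign_iter_norm; exact: sin_max.
  + by apply: cvg_sign_iter; exact: sin_max.
- exact: norm_sg.
- exact: cvg_sg_sin.
Qed.

Let Pi : set (set obs) := [set A | mult (\1_A)].

Let PiC A : Pi A -> Pi (~` A).
Proof.
rewrite /Pi /= => mA.
rewrite [X in mult X](_ : _ = fun y => 1 + -1 * \1_A y); last first.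
  by apply/funext => y; rewrite !indicE in_setC; case: (y \in A) => /=; ring.
apply: multD; first exact: mult_cst.
by apply: multM => //; exact: mult_cst.
Qed.

Let PiI A B : Pi A -> Pi B -> Pi (A `&` B).
Proof.
move=> mA mB; rewrite /Pi/= indicI.
exact: multM.
Qed.

Let PiU A B : Pi A -> Pi B -> Pi (A `|` B).
Proof. by move=> mA mB; rewrite -[A `|` B]setCK setCU; apply: PiC; apply: PiI; exact: PiC. Qed.

Let Pi0 : Pi set0.
Proof.
rewrite /Pi /= [X in mult X](_ : _ = fun=> 0); first exact: mult_cst.
by apply/funext => y; rewrite indic0.
Qed.

(** A countable union is handled as the pointwise limit of its finite partial unions, whose
    indicators are bounded by 1. *)
Let PiSigma : sigma_algebra setT Pi.
Proof.
split=> [|A mA|A mA]; first exact: Pi0.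
- by rewrite setTD; exact: PiC.
- apply: (@mult_cvg (fun n => \1_(\big[setU/set0]_(i < n) A i)) _ 1) => [n|n y|y].
  + elim: n => [|n IH]; first by rewrite big_ord0; exact: Pi0.
    by rewrite big_ord_recr /=; exact: PiU.
  + by rewrite indicE; case: (_ \in _); rewrite ?normr1 ?normr0.
  + rewrite [X in _ --> X]indicE; have [yA|yA] := boolP (y \in _).
      move/set_mem: yA => [i _ Aiy]; apply: cvg_near_cst; near=> n.
      rewrite indicE mem_set// -bigcup_mkord; exists i => //=.
      by near: n; exact: nbhs_infty_gt.
    apply: cvg_near_cst; near=> n.
    rewrite indicE memNset// -bigcup_mkord => -[i _ Aiy].
    by move/negP: yA; apply; apply: mem_set; exists i.
Unshelve. all: by end_near. Qed.

(** With [s] the sign of [y k - a], the indicator is [2^-1 * (s ^+ 2 + s)], which is 0 also for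
    [s = 0]. *)
Let Pi_ray k a : Pi [set y | a < y k].
Proof.
rewrite /Pi/=.
rewrite [X in mult X](_ : _ = fun y =>
  2^-1 * (Num.sg (y k - a) ^+ 2 + Num.sg (y k - a))); last first.
  apply/funext => y; rewrite indicE; have [ay|ay|ay] := ltgtP a (y k).
  - by rewrite mem_set// gtr0_sg ?subr_gt0//=; field.
  - rewrite memNset/=; last by rewrite ltNge (ltW ay).
    by rewrite ltr0_sg ?subr_lt0//; field.
  - by rewrite memNset/= ?ay ?ltxx// subrr sgr0; field.
apply: multM; first exact: mult_cst.
by apply: multD => //; exact: multX.
Qed.

Let Pi_measurable (A : set obs) : measurable A -> Pi A.
Proof.
apply: smallest_sub; first exact: PiSigma.
move=> _ [h [B [mB ->]]].
have sub : <<s @RGenOInfty.G R >> `<=` [set B | Pi ((fun y : obs => y h) @^-1` B)].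
  have [s0 sC sU] := PiSigma.
  apply: smallest_sub => [|_ [x ->]] /=.
    split => [|C|C mC] /=.
    - by rewrite preimage_set0.
    - by rewrite setTD preimage_setC; exact: PiC.
    - by rewrite preimage_bigcup; exact: sU.
  rewrite [X in Pi X](_ : _ = [set y | x < y h]); first exact: Pi_ray.
  by apply/funext => y/=; rewrite in_itv/= andbT.
by apply: sub; move: mB; rewrite [X in X B -> _]RGenOInfty.measurableE.
Qed.

(** A form of the Cramer-Wold theorem. The indicator of [A] is a multiplier; its product with the
    constant 1 is integrated against the wave with [h = 0] and [c = 0], which is almost surely
    [cos 0 = 1]. *)
Lemma law_unique (A : set obs) : measurable A ->
  P1 [set w | A (fun h => X1 h w)] = P2 [set w | A (fun h => X2 h w)].
Proof.
move=> mA; have [bA /(_ _ test1)[_ /(_ 0 0)]] := Pi_measurable mA.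
have bl : bm (fun y : obs => \1_A y * 1 * wave 0 0 y).
  by apply: bounded_measurableM => //; apply: bounded_measurableM => //; exact: bounded_measurable_cst.
rewrite (E1ae bl bA); last first.
  by apply: filterS (ae_zero linX1) => w /=; rewrite /wave /Y1 => ->; rewrite addr0 cos0 !mulr1.
rewrite (E2ae bl bA); last first.
  by apply: filterS (ae_zero linX2) => w /=; rewrite /wave /Y2 => ->; rewrite addr0 cos0 !mulr1.
have m1 : measurable (Y1 @^-1` A).
  rewrite -[X in measurable X]setTI.
  exact: ((measurable_into_obs mX1) measurableT A mA).
have m2 : measurable (Y2 @^-1` A).
  rewrite -[X in measurable X]setTI.
  exact: ((measurable_into_obs mX2) measurableT A mA).
have -> : E1 \1_A = fine (P1 (Y1 @^-1` A)).
  by rewrite -(setIT (Y1 @^-1` A)) -integral_indic.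
have -> : E2 \1_A = fine (P2 (Y2 @^-1` A)).
  by rewrite -(setIT (Y2 @^-1` A)) -integral_indic.
move=> e; rewrite -[LHS](fineK (fin_num_measure P1 _ m1)) e.
exact: (fineK (fin_num_measure P2 _ m2)).
Qed.

End law_unique.

(** * Normal laws: density, translation, convolution *)

Section normal_law.
Context (R : realType).
Local Notation mu := (@lebesgue_measure R).

(** The Radon-Nikodym derivative of the normal law agrees almost everywhere with [normal_pdf],
    because the two have the same integral over every measurable set. *)
Lemma integral_normal_prob (m s : R) (f : R -> \bar R) :
  measurable_fun setT f -> (forall x, (0 <= f x)%E) ->
  (\int[normal_prob m s]_x f x = \int[mu]_x (f x * (normal_pdf m s x)%:E))%E.
Proof.
move=> mf f0.
have dom := normal_prob_dominates m s.
rewrite -(Radon_Nikodym_SigmaFinite.change_of_variables dom)//.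
have mpdf : measurable_fun setT (EFin \o normal_pdf m s).
  by apply/measurable_EFinP; exact: measurable_normal_pdf.
have iRN := Radon_Nikodym_SigmaFinite.f_integrable dom.
apply: ae_eq_integral => //.
- by apply: emeasurable_funM => //; exact: measurable_int iRN.
- exact: emeasurable_funM.
- apply: ae_eqe_mul2l.
  apply: integral_ae_eq => //.
  by move=> E _ mE; rewrite -(Radon_Nikodym_SigmaFinite.f_integral dom).
Qed.

Lemma lebesgue_measure_translate (a : R) (A : set R) : measurable A ->
  mu [set x | A (x + a)] = mu A.
Proof.
move=> mA.
have mt : measurable_fun setT (fun x : measurableTypeR R => x + a : measurableTypeR R).
  exact: measurable_funD.
rewrite -[LHS]/(pushforward mu (fun x : R => x + a : measurableTypeR R) A).
apply/esym/lebesgue_measure_unique => //= _ [[x y]] _ <-.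
rewrite /pushforward /=.
rewrite (_ : _ @^-1` _ = [set` `]x - a, y - a]]); last first.
  by apply/seteqP; split => z; rewrite /= !in_itv/= ltrBlDr lerBrDr.
rewrite !lebesgue_measure_itv/= !lte_fin ltrD2r.
by case: ifP => // _; rewrite -!EFinD; congr EFin; ring.
Qed.

Lemma integral_translate (a : R) (f : R -> \bar R) :
  measurable_fun setT f -> (forall x, (0 <= f x)%E) ->
  (\int[mu]_x f (x + a)%R = \int[mu]_x f x)%E.
Proof.
move=> mf f0.
have mt : measurable_fun setT (fun x : measurableTypeR R => x + a : measurableTypeR R).
  exact: measurable_funD.
have := @ge0_integral_pushforward _ _ _ _ _ _ mt mu setT f measurableT mf (fun y _ => f0 y).
rewrite preimage_setT => <-.
by apply: eq_measure_integral => A mA _; exact: lebesgue_measure_translate.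
Qed.

Lemma normal_pdf_translate (m s a x : R) : s != 0 ->
  normal_pdf (m + a) s (x + a) = normal_pdf m s x.
Proof.
move=> s0; rewrite /normal_pdf (negbTE s0) /normal_fun.
by have -> : x + a - (m + a) = x - m by ring.
Qed.

Lemma integral_normal_prob_translate (m s a : R) (f : R -> \bar R) : s != 0 ->
  measurable_fun setT f -> (forall x, (0 <= f x)%E) ->
  (\int[normal_prob m s]_x f (x + a)%R = \int[normal_prob (m + a)%R s]_x f x)%E.
Proof.
move=> s0 mf f0.
have mfa : measurable_fun setT (fun x : R => f (x + a)%R).
  by apply: measurableT_comp => //; exact: measurable_funD.
have -> := integral_normal_prob m s mfa (fun x => f0 (x + a)).
have -> := integral_normal_prob (m + a) s mf f0.
have mg : measurable_fun setT (fun x => f x * (normal_pdf (m + a) s x)%:E)%E.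
  by apply: emeasurable_funM => //; apply/measurable_EFinP; exact: measurable_normal_pdf.
have g0 x : (0 <= f x * (normal_pdf (m + a)%R s x)%:E)%E.
  by rewrite mule_ge0// lee_fin normal_pdf_ge0.
rewrite -[RHS](integral_translate a mg g0).
by apply: eq_integral => x _; rewrite normal_pdf_translate.
Qed.

Lemma normal_probE (m s : R) (A : set R) : measurable A ->
  (normal_prob m s A = \int[normal_prob m s]_x (\1_A x)%:E)%E.
Proof. by move=> mA; rewrite integral_indic// setIT. Qed.

Lemma normal_prob_translate (m s a : R) (A : set R) : s != 0 -> measurable A ->
  normal_prob m s [set x | A (x + a)] = normal_prob (m + a) s A.
Proof.
move=> s0 mA.
have mt : measurable [set x : R | A (x + a)].
  rewrite -[X in measurable X]setTI.
  by apply: (measurable_funD (f := id) (g := cst a)) => //.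
rewrite (normal_probE m s mt) (normal_probE (m + a) s mA).
have mf : measurable_fun setT (EFin \o \1_A : R -> \bar R).
  by apply/measurable_EFinP; exact: measurable_indic.
have f0 (x : R) : (0 <= (EFin \o \1_A : R -> \bar R) x)%E by rewrite lee_fin.
have <- := integral_normal_prob_translate m a s0 mf f0.
by apply: eq_integral.
Qed.

Lemma normal_prob_integral (m s : R) (A : set R) : measurable A ->
  (normal_prob m s A = \int[mu]_x ((\1_A x)%:E * (normal_pdf m s x)%:E))%E.
Proof.
move=> mA; rewrite (normal_probE m s mA).
have mf : measurable_fun setT (EFin \o \1_A : R -> \bar R).
  by apply/measurable_EFinP; exact: measurable_indic.
have f0 (x : R) : (0 <= (EFin \o \1_A : R -> \bar R) x)%E by rewrite lee_fin.
have e := integral_normal_prob m s mf f0.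
by rewrite /= in e; exact: e.
Qed.

Lemma normal_pdf0E (m s x : R) : s != 0 ->
  normal_pdf m s x = normal_peak s * normal_fun m s x.
Proof. by move=> s0; rewrite /normal_pdf (negbTE s0). Qed.

Lemma normal_peakE (s : R) : normal_peak s = (`|s| * Num.sqrt (pi *+ 2))^-1.
Proof. by rewrite /normal_peak -mulrnAr sqrtrM ?sqr_ge0// sqrtr_sqr. Qed.

(* Both sides are the joint density of (X, aX + bY) at (x, v), with X and Y
   independent standard normal: conditioned on X on the left, on aX + bY on the
   right. *)
Lemma normal_pdf_swap (a b r x v : R) : b != 0 -> 0 < r -> r ^+ 2 = a ^+ 2 + b ^+ 2 ->
  normal_pdf 0 1 x * normal_pdf (a * x) b v =
  normal_pdf 0 r v * normal_pdf (a * v / r ^+ 2) (b / r) x.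
Proof.
move=> b0 r0 rE.
have r0' : r != 0 by rewrite gt_eqF.
have br0 : b / r != 0 by rewrite mulf_neq0// invr_eq0.
have P : normal_peak 1 * normal_peak b = normal_peak r * normal_peak (b / r) :> R.
  rewrite !normal_peakE -!invfM normr1 normf_div (gtr0_norm r0) mul1r.
  congr (_^-1); move: (Num.sqrt _) `|b| => S B.
  by field.
have E : - (x - 0) ^+ 2 / (1 ^+ 2 *+ 2) + - (v - a * x) ^+ 2 / (b ^+ 2 *+ 2) =
   - (v - 0) ^+ 2 / (r ^+ 2 *+ 2) + - (x - a * v / r ^+ 2) ^+ 2 / ((b / r) ^+ 2 *+ 2).
  rewrite expr_div_n rE; have rE0 : a ^+ 2 + b ^+ 2 != 0 by rewrite -rE sqrf_eq0.
  by field; rewrite b0 rE0.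
have F : normal_fun 0 1 x * normal_fun (a * x) b v =
    normal_fun 0 r v * normal_fun (a * v / r ^+ 2) (b / r) x.
  by rewrite /normal_fun -expRD E expRD.
rewrite (normal_pdf0E _ _ b0) (normal_pdf0E _ _ r0') (normal_pdf0E _ _ br0).
rewrite (normal_pdf0E _ _ (oner_neq0 _)).
by rewrite mulrACA P F mulrACA.
Qed.

(** After Tonelli and [normal_pdf_swap], the inner integral over [x] is that of a normal density,
    hence 1, and only the density with standard deviation [r] remains. *)
Lemma normal_convolution (a b : R) (A : set R) : b != 0 -> measurable A ->
  (\int[normal_prob 0 1]_x normal_prob (a * x)%R b A =
   normal_prob 0 (Num.sqrt (a ^+ 2 + b ^+ 2))%R A)%E.
Proof.
move=> b0 mA; set r := Num.sqrt _.
have rE : r ^+ 2 = a ^+ 2 + b ^+ 2 by rewrite sqr_sqrtr// addr_ge0// sqr_ge0.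
have r0 : 0 < r by rewrite sqrtr_gt0 ltr_wpDl ?sqr_ge0// exprn_even_gt0.
have r0' : r != 0 by rewrite gt_eqF.
have mpdf (m s : R) : measurable_fun setT (EFin \o normal_pdf m s).
  by apply/measurable_EFinP; exact: measurable_normal_pdf.
have mpdf2 (c s : R) : s != 0 ->
    measurable_fun setT (fun p : R * R => normal_pdf (c * p.1) s p.2).
  move=> s0; rewrite /normal_pdf (negbTE s0); apply: measurable_funM => //.
  rewrite /normal_fun; apply: measurableT_comp => //.
  apply: measurable_funM => //; apply: measurableT_comp => //.
  apply: measurable_funX; apply: measurable_funB => //.
  exact: measurable_funM.
have mI : measurable_fun setT (fun p : R * R => \1_A p.2 : R).
  exact: (measurableT_comp (@measurable_indic _ _ R setT A mA) (@measurable_snd _ _ R R)).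
have mN c s : s != 0 -> measurable_fun setT (fun x : R => normal_prob (c * x) s A).
  move=> s0.
  rewrite [X in measurable_fun _ X](_ : _ = fun x => \int[mu]_v
     ((\1_A v)%:E * (normal_pdf (c * x)%R s v)%:E))%E; last first.
    by apply/funext => x; rewrite normal_prob_integral.
  apply: (@measurable_fun_fubini_tonelli_F _ _ _ _ _ mu
    (fun p : R * R =>
    ((\1_A p.2)%:E * (normal_pdf (c * p.1)%R s p.2)%:E)%E)).
  - apply: emeasurable_funM; apply/measurable_EFinP; last exact: mpdf2.
    exact: mI.
  - by move=> p; rewrite mule_ge0// lee_fin ?normal_pdf_ge0.
have -> := integral_normal_prob 0 1 (mN a b b0) (fun x => measure_ge0 _ _).
transitivity (\int[mu]_x \int[mu]_v
    ((\1_A v)%:E * (normal_pdf 0 1 x * normal_pdf (a * x) b v)%R%:E))%E.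
  apply: eq_integral => x _; rewrite normal_prob_integral//.
  rewrite -ge0_integralZr//.
  - by apply: eq_integral => v _; rewrite -!EFinM; congr EFin; ring.
  - by apply: emeasurable_funM; apply/measurable_EFinP;
      [exact: (@measurable_indic _ _ R setT A mA)|exact: measurable_normal_pdf].
  - by move=> v _; rewrite mule_ge0// lee_fin normal_pdf_ge0.
  - by rewrite lee_fin normal_pdf_ge0.
rewrite (@fubini_tonelli _ _ _ _ _ mu mu (fun p => ((\1_A p.2)%:E *
    (normal_pdf 0 1 p.1 * normal_pdf (a * p.1) b p.2)%R%:E)%E)); last 2 first.
- apply: emeasurable_funM; apply/measurable_EFinP.
    exact: mI.
  apply: measurable_funM; last exact: mpdf2.
  by apply: measurableT_comp => //; exact: measurable_normal_pdf.
- by move=> p; rewrite mule_ge0// lee_fin ?mulr_ge0 ?normal_pdf_ge0.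
rewrite normal_prob_integral//.
apply: eq_integral => v _ /=.
under eq_integral do rewrite (normal_pdf_swap _ _ b0 r0 rE) EFinM muleA.
rewrite ge0_integralZl//.
- by rewrite integral_normal_pdf mule1.
- by apply/measurable_EFinP; exact: measurable_normal_pdf.
- by move=> x _; rewrite lee_fin normal_pdf_ge0.
- by rewrite mule_ge0// lee_fin normal_pdf_ge0.
Qed.

End normal_law.

(** * The product of two probabilities *)

Section product_probability.
Context d1 d2 (T1 : measurableType d1) (T2 : measurableType d2) (R : realType).
Variables (P1 : probability T1 R) (P2 : probability T2 R).

Let product_setT : (P1 \x P2)%E setT = 1%E.
Proof.
rewrite -setXTT [LHS]product_measure1E// -[RHS]mule1.
by congr (_ * _)%E; exact: probability_setT.
Qed.

HB.instance Definition _ := Measure.on (P1 \x P2)%E.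
HB.instance Definition _ :=
  Measure_isProbability.Build _ _ _ (P1 \x P2)%E product_setT.

Definition product_probability : probability (T1 * T2)%type R := (P1 \x P2)%E.

End product_probability.

(** * Slicing the noise along a unit vector *)

Section gaussian_shift.
Context (R : realType) (H : completeNormedModType R) (ip : {dot H for idfun}).
Hypothesis ip_norm : forall h : H, ip h h = `|h| ^+ 2.
Context d (T : measurableType d) (P : probability T R) (eps : H -> {RV P >-> R}).
Hypothesis eps_gaussian : standard_gaussian eps.
Local Notation obs := (obs_space H R).
Local Notation mu := (@lebesgue_measure R).
Local Notation N := (@normal_prob R).

Lemma ipC h k : ip h k = ip k h.
Proof. by have := @hermC _ _ _ _ ip h k; rewrite expr0 mul1r. Qed.

Lemma ipZr a h k : ip h (a *: k) = a * ip h k.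
Proof. by rewrite linearZr. Qed.

Lemma ipZl a h k : ip (a *: h) k = a * ip h k.
Proof. by rewrite ipC ipZr ipC. Qed.

Let eps_lin := proj1 eps_gaussian.

Lemma noise_zero : {ae P, forall w, eps 0 w = 0}.
Proof. exact: (ae_zero eps_lin). Qed.

Lemma noise_scale a k : {ae P, forall w, eps (a *: k) w = a * eps k w}.
Proof. exact: (ae_scalar eps_lin). Qed.

Lemma noise_law (h : H) (B : set R) : h != 0 -> measurable B ->
  P [set w | B (eps h w)] = N 0 `|h| B.
Proof.
move=> h0 mB; have [_ /(_ h B mB)] := eps_gaussian.
by rewrite normr_eq0 (negbTE h0).
Qed.

Lemma measurable_noise h : measurable_fun setT (eps h).
Proof. by []. Qed.

(** The mean is an arbitrary vector of [H], so that shifts need not come from a parameter;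
    [observation] at [f] unfolds to the case [m = K f]. *)
Definition observe (m : H) (sigma : R) (w : T) : obs :=
  fun h => ip m h + sigma * eps h w.

Lemma measurable_observe m sigma : measurable_fun setT (observe m sigma).
Proof.
apply: measurable_into_obs => h.
by apply: measurable_funD => //; apply: measurable_funM => //.
Qed.

Let proj_off (u h : H) := h - ip h u *: u.

(* The observation whose coordinate along the unit vector u is x and whose
   orthogonal part is that of the noise. *)
Definition slice (m u : H) (sigma x : R) (w : T) : obs :=
  fun h => ip m h + sigma * (ip h u * x + eps (proj_off u h) w).

Definition slice_prob (m u : H) (sigma : R) (A : set obs) (x : R) : \bar R :=
  P [set w | A (slice m u sigma x w)].

Lemma measurable_slice m u sigma :
  measurable_fun setT (fun p : R * T => slice m u sigma p.1 p.2).
Proof.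
apply: (@measurable_into_obs R H _ (R * T)%type
  (fun h p => ip m h + sigma * (ip h u * p.1 + eps (proj_off u h) p.2))) => h.
apply: measurable_funD => //; apply: measurable_funM => //.
apply: measurable_funD; first exact: measurable_funM.
exact: measurableT_comp.
Qed.

Lemma measurable_slice1 m u sigma x :
  measurable_fun setT (slice m u sigma x).
Proof.
apply: (@measurable_into_obs R H _ T
  (fun h w => ip m h + sigma * (ip h u * x + eps (proj_off u h) w))) => h.
by apply: measurable_funD => //; apply: measurable_funM => //;
  apply: measurable_funD.
Qed.

Lemma measurable_slice_prob m u sigma (A : set obs) : measurable A ->
  measurable_fun setT (slice_prob m u sigma A).
Proof.
move=> mA.
have mS := measurable_preimage (measurable_slice m u sigma) mA.
have := measurable_fun_xsection P mS.
rewrite (_ : _ \o _ = slice_prob m u sigma A)//.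
apply/funext => x /=; rewrite /slice_prob; congr (P _).
by apply/seteqP; split => w /=; rewrite /xsection/= inE.
Qed.

Lemma slice_prob_le1 m u sigma (A : set obs) x : measurable A ->
  (0 <= slice_prob m u sigma A x <= 1)%E.
Proof.
move=> mA; rewrite measure_ge0/= probability_le1//.
exact: measurable_preimage (measurable_slice1 m u sigma x) mA.
Qed.

Let ip_off u h : `|u| = 1 -> `|h| ^+ 2 = ip h u ^+ 2 + `|proj_off u h| ^+ 2.
Proof.
move=> u1; rewrite -!ip_norm /proj_off.
rewrite linearBl !linearBr/= !linearZl_LR/= !ipZr (ipC u h) (ip_norm u) u1.
by ring.
Qed.

(** By [law_unique] it is enough to compare the coordinates at one [h]. On the right, independent
    centered normal variables of variances [ip h u ^+ 2] and the squared norm of [proj_off u h] are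
    added; by Pythagoras the variances sum to the squared norm of [h]. *)
Lemma noise_slice u (A : set obs) : `|u| = 1 -> measurable A ->
  P [set w | A (fun h => eps h w)] =
  (\int[N 0 1]_x P [set w | A (fun h => (ip h u * x + eps (proj_off u h) w)%R)])%E.
Proof.
move=> u1 mA.
pose X2 h (p : R * T) := ip h u * p.1 + eps (proj_off u h) p.2.
have mX2 h : measurable_fun setT (X2 h).
  by apply: measurable_funD; [exact: measurable_funM|exact: measurableT_comp].
pose prodNP := product_probability (normal_prob 0 1) P.
transitivity (prodNP [set p | A (fun h => X2 h p)]); last first.
  rewrite /= /product_measure1; apply: eq_integral => x _ /=.
  by congr (P _); apply/seteqP; split => w /=; rewrite /xsection/= inE.
apply: (law_unique (X1 := fun h w => eps h w)) => //.
  (* Linearity of the sliced noise can fail only over the null set [M] of the second factor,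
     whatever [x] is. *)
  move=> a h k; have [M [mM M0 sub]] := eps_lin a (proj_off u h) (proj_off u k).
  exists (setT `*` M); split; first exact: measurableX.
    rewrite [LHS]product_measure1E//; apply/eqP; rewrite mule_eq0; apply/orP; right.
    by apply/eqP; exact: M0.
  move=> [x w] /= bad; split => //; apply: sub => /= e; apply: bad.
  rewrite /X2/= (_ : proj_off u (a *: h + k) = a *: proj_off u h + proj_off u k).
    by rewrite e linearDl linearZl_LR/=; ring.
  rewrite /proj_off linearDl linearZl_LR/= scalerDl scalerBr opprD scalerA.
  by rewrite addrACA.
move=> h B mB.
have -> : prodNP (X2 h @^-1` B) =
    (\int[N 0 1]_x P [set w | B (ip h u * x + eps (proj_off u h) w)%R])%E.
  rewrite /= /product_measure1; apply: eq_integral => x _ /=.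
  by congr (P _); apply/seteqP; split => w /=; rewrite /xsection/= inE.
have u0 : u != 0 by rewrite -normr_gt0 u1.
have hE := ip_off h u1.
(* If [h] is a multiple of [u], the orthogonal part is the noise at 0, whose law is a Dirac mass;
   there is no density to convolve with, and almost sure equalities are used instead. *)
have [r0|r0] := eqVneq (proj_off u h) 0.
  have hu : h = ip h u *: u by apply/eqP; rewrite -subr_eq0; exact/eqP.
  transitivity (P [set w | B (ip h u * eps u w)]).
    apply: ae_eq_measure.
    - exact: measurable_preimage (measurable_noise h) mB.
    - by apply: measurable_preimage mB; exact: measurable_funM.
    - by apply: filterS (noise_scale (ip h u) u) => w /= e; rewrite {1}hu e.
  have mB' : measurable [set x | B (ip h u * x)].
    by apply: measurable_preimage mB; exact: measurable_funM.
  rewrite [LHS](noise_law u0 mB') u1 (normal_probE 0 1 mB').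
  apply: eq_integral => x _.
  rewrite r0 indicE; have [Bx|Bx] := boolP (_ \in _).
    rewrite -(probability_setT P); apply: ae_eq_measure => //.
      by apply: measurable_preimage mB; exact: measurable_funD.
    apply: filterS noise_zero => w /= ->; rewrite addr0; split => // _.
    by move: Bx; rewrite inE.
  transitivity (P set0); first by rewrite measure0.
  apply: ae_eq_measure => //.
    by apply: measurable_preimage mB; exact: measurable_funD.
  apply: filterS noise_zero => w /= ->; rewrite addr0; split => // Bx'.
  by move/negP: Bx; apply; rewrite inE.
have r0' : `|proj_off u h| != 0 by rewrite normr_eq0.
have h0 : h != 0.
  apply: contra_neq r0 => h0; rewrite /proj_off h0 linear0l scale0r subr0//.
rewrite [LHS](noise_law h0 mB).
have -> : `|h| = Num.sqrt (ip h u ^+ 2 + `|proj_off u h| ^+ 2).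
  by rewrite -hE sqrtr_sqr normr_id.
rewrite -(normal_convolution (ip h u) r0' mB).
apply: eq_integral => x _.
rewrite -[in LHS](add0r (ip h u * x)) -(normal_prob_translate 0 _ r0' mB).
rewrite -(noise_law r0)//.
  by congr (P _); apply/seteqP; split => w /=; rewrite addrC.
by apply: measurable_preimage mB; exact: measurable_funD.
Qed.

(** Moving the mean by [sigma * s] along [u] adds [s] to the coordinate [x] and leaves the
    orthogonal part alone; only the mixing law changes, from N(0, 1) to N(s, 1). *)
Lemma shift_law m u sigma s (A : set obs) : `|u| = 1 -> measurable A ->
  P [set w | A (observe (m + (sigma * s) *: u) sigma w)] =
  (\int[N s 1]_x slice_prob m u sigma A x)%E.
Proof.
move=> u1 mA.
pose phi (y : obs) : obs := fun h => ip m h + sigma * (s * ip u h + y h).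
have mphi : measurable_fun setT phi.
  apply: (@measurable_into_obs R H _ obs (fun h (y : obs) => ip m h + sigma * (s * ip u h + y h))) => h.
  apply: measurable_funD => //; apply: measurable_funM => //; apply: measurable_funD => //.
  exact: measurable_coordinate.
have mA' := measurable_preimage mphi mA.
transitivity (P [set w | A (phi (fun h => eps h w))]).
  congr (P _); apply/funext => w /=; congr (A _); apply/funext => h.
  by rewrite /phi /observe linearDl linearZl_LR/=; ring.
have -> := noise_slice u1 mA'.
have one0 : (1 : R) != 0 by exact: oner_neq0.
have := integral_normal_prob_translate 0 s one0 (measurable_slice_prob m u sigma mA)
  (fun x => measure_ge0 _ _).
rewrite add0r => <-.
apply: eq_integral => x _; rewrite /slice_prob; congr (P _).
apply/funext => w /=; congr (A _); apply/funext => h.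
by rewrite /phi /slice (ipC u h); ring.
Qed.

End gaussian_shift.

(** * Testing a shift of the standard normal law *)

Section one_dimensional_tests.
Context (R : realType).
Local Notation mu := (@lebesgue_measure R).
Local Notation phi m := (normal_pdf m (1 : R)).

Lemma normal_pdf_tilt (s x : R) :
  phi s x = phi 0 x * expR (s * x - s ^+ 2 / 2).
Proof.
have one0 : (1 : R) != 0 by exact: oner_neq0.
rewrite !(normal_pdf0E _ _ one0) -mulrA; congr (_ * _).
rewrite /normal_fun -expRD; congr expR.
by field.
Qed.

Lemma normal_pdf_gt0 (m x : R) : 0 < phi m x.
Proof.
have one0 : (1 : R) != 0 by exact: oner_neq0.
by rewrite (normal_pdf0E _ _ one0) mulr_gt0 ?normal_peak_gt0// expR_gt0.
Qed.

Lemma bounded_measurable_pdf_integrable (f : R -> R) m : bounded_measurable f ->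
  mu.-integrable setT (fun x => (f x * phi m x)%:E).
Proof.
move=> [mf [M fM]].
have mphi : measurable_fun setT (phi m) by exact: measurable_normal_pdf.
apply: (@le_integrable _ _ _ mu setT _ _ (fun x => (M * phi m x)%:E)) => //.
- by apply/measurable_EFinP; exact: measurable_funM.
- move=> x _; rewrite !abse_EFin lee_fin normrM (ger0_norm (normal_pdf_ge0 _ _ _)).
  apply: (le_trans _ (ler_norm _)).
  by rewrite ler_wpM2r// normal_pdf_ge0.
- rewrite (_ : (fun x => _) = (fun x => M%:E * (phi m x)%:E))%E//.
  by apply: integrableZl => //; exact: integrable_normal_pdf.
Qed.

Lemma normal_integralE (p : R -> \bar R) m : measurable_fun setT p ->
  (forall x, 0 <= p x <= 1)%E ->
  (\int[normal_prob m 1]_x p x = (\int[mu]_x (fine (p x) * phi m x))%:E)%E.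
Proof.
move=> mp p01.
have pfin x : p x \is a fin_num.
  by have /andP[p0 p1] := p01 x; rewrite ge0_fin_numE// (le_lt_trans p1)// ltry.
have bm : bounded_measurable (fine \o p).
  split; first exact: (measurableT_comp (@fine_measurable R setT measurableT) mp).
  exists 1 => x /=; have /andP[p0 p1] := p01 x.
  by rewrite ger0_norm ?fine_ge0// -lee_fin fineK.
rewrite (integral_normal_prob _ _ mp); last by move=> x; have /andP[] := p01 x.
rewrite /Rintegral fineK; last first.
  by apply: integrable_fin_num => //; exact: bounded_measurable_pdf_integrable.
by apply: eq_integral => x _; rewrite EFinM /= fineK.
Qed.

(* Randomized tests against a shift: the integrand below is nonnegative because
   the likelihood ratio [phi s / phi 0] is increasing and equals
   [expR (s * z - s ^+ 2 / 2)] at [z]. *)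
Lemma neyman_pearson (p : R -> \bar R) (s z : R) : 0 < s ->
  measurable_fun setT p -> (forall x, 0 <= p x <= 1)%E ->
  (normal_prob 0 1 `]-oo, z] <= \int[normal_prob 0 1]_x p x)%E ->
  (normal_prob s 1 `]-oo, z] <= \int[normal_prob s 1]_x p x)%E /\
  ((\int[normal_prob s 1]_x p x = normal_prob s 1 `]-oo, z])%E ->
   (\int[normal_prob 0 1]_x p x = normal_prob 0 1 `]-oo, z])%E /\
   {ae mu, forall x, p x = (\1_(`]-oo, z] : set R) x)%:E}).
Proof.
move=> s0 mp p01.
have pfin x : p x \is a fin_num.
  by have /andP[p0 p1] := p01 x; rewrite ge0_fin_numE// (le_lt_trans p1)// ltry.
pose q := fine \o p; pose a : R -> R := \1_(`]-oo, z] : set R).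
have mq : measurable_fun setT q.
  exact: (measurableT_comp (@fine_measurable R setT measurableT) mp).
have q01 x : 0 <= q x <= 1.
  have /andP[p0 p1] := p01 x.
  by rewrite fine_ge0//= -lee_fin fineK.
have bq : bounded_measurable q.
  by split => //; exists 1 => x; have /andP[h1 h2] := q01 x; rewrite ger0_norm.
have a01 x : 0 <= a x <= 1 by rewrite /a indicE; case: (_ \in _); rewrite lexx ler01.
have ba : bounded_measurable a.
  split; first exact: measurable_indic.
  by exists 1 => x; have /andP[h1 h2] := a01 x; rewrite ger0_norm.
have aE m : normal_prob m 1 `]-oo, z] = (\int[mu]_x (a x * phi m x))%:E.
  rewrite (normal_probE m 1)//.
  have ma : measurable_fun setT (EFin \o a) by apply/measurable_EFinP; case: ba.
  by rewrite (normal_integralE m ma).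
have pE m : (\int[normal_prob m 1]_x p x)%E = (\int[mu]_x (q x * phi m x))%:E.
  exact: normal_integralE.
rewrite !aE !pE !lee_fin.
set k := expR (s * z - s ^+ 2 / 2).
have k0 : 0 < k by exact: expR_gt0.
pose D x := (q x - a x) * (phi s x - k * phi 0 x).
have D0 x : 0 <= D x.
  rewrite /D normal_pdf_tilt (mulrC (phi 0 x)) -mulrBl mulrA.
  rewrite mulr_ge0 ?normal_pdf_ge0//.
  have /andP[q0 q1] := q01 x.
  rewrite /a indicE; have [xz|xz] := boolP (_ \in _).
    move: xz; rewrite inE/= in_itv/= => xz.
    rewrite mulr_le0 ?subr_le0// ler_expR lerD2r ler_pM2l//.
  move/negP: xz; rewrite inE/= in_itv/= => /negP; rewrite -ltNge => xz.
  by rewrite mulr_ge0 ?subr0// subr_ge0 ler_expR lerD2r ler_pM2l// ltW.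
have iq m := bounded_measurable_pdf_integrable m bq.
have ia m := bounded_measurable_pdf_integrable m ba.
have iB m : mu.-integrable setT (EFin \o (fun x => q x * phi m x - a x * phi m x)).
  by rewrite (_ : EFin \o _ = (fun x => (q x * phi m x)%:E - (a x * phi m x)%:E)%E)//;
    exact: integrableB.
have iZ : mu.-integrable setT (EFin \o (fun x => k * (q x * phi 0 x - a x * phi 0 x))).
  by rewrite (_ : EFin \o _ = (fun x => k%:E * (q x * phi 0 x - a x * phi 0 x)%:E)%E)//;
    apply: integrableZl => //; exact: iB.
have DB : D = fun x => (q x * phi s x - a x * phi s x) - k * (q x * phi 0 x - a x * phi 0 x).
  by apply/funext => x; rewrite /D; ring.
have DE : \int[mu]_x D x = (\int[mu]_x (q x * phi s x) - \int[mu]_x (a x * phi s x))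
    - k * (\int[mu]_x (q x * phi 0 x) - \int[mu]_x (a x * phi 0 x)).
  rewrite DB (RintegralB measurableT (iB s) iZ) (RintegralZl _ measurableT (iB 0)).
  by rewrite !(RintegralB measurableT (iq _) (ia _)).
have iD : mu.-integrable setT (EFin \o D).
  rewrite DB (_ : EFin \o _ = (fun x => (q x * phi s x - a x * phi s x)%:E -
    (k * (q x * phi 0 x - a x * phi 0 x))%:E)%E)//.
  by apply: integrableB => //; exact: iB.
have DI : 0 <= \int[mu]_x D x by apply: Rintegral_ge0.
move=> h0.
have h1 : \int[mu]_x (a x * phi s x) <= \int[mu]_x (q x * phi s x).
  move: DI; rewrite DE subr_ge0 => DI; rewrite -subr_ge0; apply: le_trans DI.
  by rewrite mulr_ge0 ?(ltW k0)// subr_ge0.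
(* Under equality at [s], the integral of the nonnegative [D] becomes [- k] times a nonnegative
   difference; both are therefore 0, and [D] vanishes almost everywhere. *)
split=> // -[e]; have D00 : \int[mu]_x D x = 0.
  apply/eqP; rewrite eq_le DI andbT DE e subrr sub0r oppr_le0.
  by rewrite mulr_ge0 ?(ltW k0)// subr_ge0.
split.
  congr EFin; move: D00; rewrite DE e subrr sub0r => /eqP.
  by rewrite oppr_eq0 mulf_eq0 (gt_eqF k0)/= subr_eq0 => /eqP.
have mD : measurable_fun setT (EFin \o D) by exact: measurable_int iD.
have /(ae_eq_integral_abs mu measurableT mD) : (\int[mu]_x `|(EFin \o D) x| = 0)%E.
  rewrite -[RHS]/(0%:E) -D00 /Rintegral fineK; last exact: integrable_fin_num.
  by apply: eq_integral => x _; rewrite /= ger0_norm.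
(* The likelihood ratio takes the value [k] only at [z]; elsewhere [D x = 0] forces [q x = a x]. *)
move=> Dae; have Nz : {ae mu, forall x : R, x <> z}.
  exists [set z]; split => //; first by rewrite lebesgue_measure_set1.
  by move=> x /= /contrapT.
apply: filterS2 Dae Nz => x /(_ I) /= [] /eqP.
rewrite /D normal_pdf_tilt (mulrC (phi 0 x)) -mulrBl mulf_eq0 mulf_eq0.
rewrite (gt_eqF (normal_pdf_gt0 0 x)) orbF subr_eq0 subr_eq0.
move=> /orP[/eqP qa _|]; first by rewrite -(fineK (pfin x)) -[fine _]/(q x) qa.
move=> /eqP/expR_inj/addIr/(mulfI (lt0r_neq0 s0)) xz /(_ xz).
by [].
Qed.

(* Anderson's inequality on the line: compare [normal_pdf] with its value at the
   endpoints. *)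
Lemma normal_prob_centered_itv (m t : R) : 0 <= t ->
  (normal_prob m 1 `[(- t)%R, t] <= normal_prob 0 1 `[(- t)%R, t])%E.
Proof.
move=> t0; have one0 : (1 : R) != 0 by exact: oner_neq0.
set A : set R := `[- t, t]%classic.
have mA : measurable A by exact: measurable_itv.
pose A' := [set x | A (x + m)].
have mA' : measurable A' by apply: measurable_preimage mA; exact: measurable_funD.
rewrite -{1}(add0r m) -(normal_prob_translate 0 m one0 mA).
rewrite (normal_prob_integral 0 1 mA) (normal_prob_integral 0 1 mA') -/A'.
set c := phi 0 t.
have c0 : 0 <= c by exact: normal_pdf_ge0.
have mI (B : set R) : measurable B -> measurable_fun setT (fun x : R => (\1_B x)%:E).
  by move=> mB; apply/measurable_EFinP; exact: measurable_indic.
have mphi : measurable_fun setT (fun x => (phi 0 x)%:E).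
  by apply/measurable_EFinP; exact: measurable_normal_pdf.
have cE (B : set R) : measurable B -> (\int[mu]_x ((\1_B x)%:E * c%:E) = mu B * c%:E)%E.
  move=> mB; rewrite ge0_integralZr ?integral_indic ?setIT//.
  exact: mI.
have lA : mu A' = mu A by exact: lebesgue_measure_translate.
have fA : (mu A * c%:E)%E \is a fin_num.
  rewrite lebesgue_measure_itv/=; case: ifP => _; last by rewrite mul0e.
  by rewrite -EFinB -EFinM.
have mIc (B : set R) (r : R -> \bar R) : measurable B -> measurable_fun setT r ->
    measurable_fun setT (fun x : R => ((\1_B x)%:E * r x)%E).
  by move=> mB mr; apply: emeasurable_funM => //; exact: mI.
have ge0 (B : set R) (r : R -> R) x : 0 <= r x -> (0 <= (\1_B x)%:E * (r x)%:E)%E.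
  by move=> r0; rewrite mule_ge0// lee_fin.
have phi0 x : 0 <= phi 0 x by exact: normal_pdf_ge0.
(* The equal finite quantities [mu A * c] and [mu A' * c] are added to the two sides. The claim then
   follows from a pointwise inequality, true because [phi 0 x >= c] exactly when [x] is in [A]. *)
rewrite -(leeD2rE _ _ fA) -{1}(cE A mA) -{1}lA -(cE A' mA').
rewrite -(ge0_integralD mu measurableT (fun x _ => ge0 A' _ x (phi0 x)) (mIc _ _ mA' mphi)
  (fun x _ => ge0 A (fun=> c) x c0) (mIc _ _ mA (measurable_cst _))).
rewrite -(ge0_integralD mu measurableT (fun x _ => ge0 A _ x (phi0 x)) (mIc _ _ mA mphi)
  (fun x _ => ge0 A' (fun=> c) x c0) (mIc _ _ mA' (measurable_cst _))).
apply: ge0_le_integral => //.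
- by move=> x _; rewrite adde_ge0// ge0.
- by apply: emeasurable_funD; [exact: mIc|apply: mIc].
- by apply: emeasurable_funD; [exact: mIc|apply: mIc].
move=> x _; rewrite -!EFinM -!EFinD lee_fin.
have cmp (x1 x2 : R) : (phi 0 x1 <= phi 0 x2) = (`|x2| <= `|x1|).
  rewrite !(normal_pdf0E _ _ one0) ler_pM2l ?normal_peak_gt0//.
  rewrite /normal_fun ler_expR !subr0 !expr1n ler_pM2r ?invr_gt0//.
  by rewrite lerN2 -(ler_sqr (x := `|x2|)) ?nnegrE// !real_normK// num_real.
have AE (y : R) : (y \in A) = (`|y| <= t).
  by apply/idP/idP; rewrite inE /A/= in_itv/= -ler_norml.
rewrite !indicE AE; have [xt|xt] := leP `|x| t.
  have : c <= phi 0 x by rewrite /c cmp (ger0_norm t0).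
  by case: (x \in A') => /=; lra.
have : phi 0 x <= c by rewrite /c cmp (ger0_norm t0) ltW.
by case: (x \in A') => /=; lra.
Qed.

End one_dimensional_tests.

Definition mfun_of d d' (T : measurableType d) (T' : measurableType d') (f : T -> T')
    (mf : measurable_fun setT f) : {mfun T >-> T'} :=
  HB.pack f (isMeasurableFun.Build _ _ _ _ _ mf).

(** * Quantiles of atomless laws *)

Section quantiles.
Context (R : realType).

(** Right-continuity of the distribution function at the infimum [b] gives a value of at least [q].
    No point to the left of [b] is in [S], so the open ray below [b] has probability at most [q],
    and [b] itself carries no mass. *)
Lemma cdf_quantile d (T : measurableType d) (P : probability T R) (X : {RV P >-> R}) (q : R) :
  0 < q < 1 -> (forall x, P (X @^-1` [set x]) = 0%E) ->
  distribution P X `]-oo, quantile (distribution P X) q] = q%:E /\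
  forall y, (q%:E <= distribution P X `]-oo, y])%E -> quantile (distribution P X) q <= y.
Proof.
move=> /andP[q0 q1] atomless.
pose F := cdf X; pose G := fine \o F; pose S := [set x : R | (q%:E <= F x)%E].
set b := quantile _ _; rewrite -[distribution P X _]/(F b).
have bE : b = inf S by [].
have Ffin x : F x \is a fin_num by exact: fin_num_measure.
have SE x : S x = (q <= G x) by rewrite /S/= /G/= -lee_fin fineK.
have Gy : G @ +oo --> (1 : R) by exact/fine_cvg/cvg_cdfy1.
have GNy : G @ -oo --> (0 : R) by exact/fine_cvg/cvg_cdfNy0.
have S0 : S !=set0.
  have [M [_ HM]] := cvgr_gt _ Gy _ q1.
  by exists (M + 1); rewrite SE ltW// HM// ltrDl.
have Slb : has_lbound S.
  have [M [_ HM]] := cvgr_lt _ GNy _ q0.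
  exists M => x; rewrite SE => qx; rewrite leNgt; apply/negP => xM.
  by have := HM _ xM; rewrite ltNge qx.
have hiS : has_inf S by split.
split; last by move=> y qy; rewrite bE; exact: ge_inf.
suff Gb : G b = q by rewrite -[LHS]fineK// -[fine _]/(G b) Gb.
apply/eqP; rewrite eq_le; apply/andP; split; last first.
  rewrite leNgt; apply/negP => Gbq.
  have Gr : G x @[x --> b^'+] --> G b.
    by apply: fine_cvg; rewrite fineK//; exact: cdf_right_continuous.
  have [e /= e0 He] := cvgr_lt _ Gr _ Gbq.
  have [s Ss sbe] := inf_adherent e0 hiS.
  have : b <= s by rewrite bE; exact: ge_inf.
  rewrite le_eqVlt => /orP[/eqP bs|bs].
    by move: Ss; rewrite SE -bs leNgt Gbq.
  move: Ss; rewrite SE leNgt => /negP; apply; apply: He => //=.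
  rewrite ltr0_norm ?subr_lt0// opprB ltrBlDr addrC.
  by rewrite bE.
rewrite -lee_fin /G/= fineK//.
pose E n := X @^-1` `]-oo, b - n.+1%:R^-1].
have mE n : measurable (E n) by exact: measurable_funPTI.
have UE : \bigcup_n E n = X @^-1` `]-oo, b[.
  apply/seteqP; split => [w [n _]|w] /=; rewrite /E/= !in_itv/=.
    by move=> /le_lt_trans; apply; rewrite ltrBlDr ltrDl invr_gt0.
  move=> wb; have : 0 < b - X w by rewrite subr_gt0.
  move=> /ltr_add_invr[n]; rewrite add0r => h.
  by exists n => //=; rewrite in_itv/= lerBrDr addrC -lerBrDr ltW.
have cE : P (E n) @[n --> \oo] --> P (X @^-1` `]-oo, b[).
  rewrite -UE; apply: nondecreasing_cvg_mu => //; first exact: bigcup_measurable.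
  move=> m n mn; apply/subsetPset => w; rewrite /E/= !in_itv/= => /le_trans; apply.
  by rewrite lerD2l lerN2 lef_pV2 ?posrE// ler_nat.
have Pb : (P (X @^-1` `]-oo, b[) <= q%:E)%E.
  apply: (cvge_to_le cE).
  near=> n; have : ~ S (b - n.+1%:R^-1).
    move=> /(ge_inf Slb); rewrite -bE leNgt => /negP; apply.
    by rewrite ltrBlDr ltrDl invr_gt0.
  rewrite /S /= => /negP; rewrite -ltNge => /ltW.
  exact.
have -> : F b = P (X @^-1` `]-oo, b[ `|` X @^-1` [set b]).
  rewrite /F /cdf /distribution/= /pushforward -preimage_setU; congr (P (_ @^-1` _)).
  apply/seteqP; split => x /=; rewrite !in_itv/= le_eqVlt.
    by move=> /orP[/eqP|]; [right|left].
  by move=> [->|->]; rewrite ?orbT ?eqxx.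
have Pz : (P (X @^-1` [set b]) <= 0)%E by rewrite atomless.
apply: (le_trans (measureU2 _ _ _)) => //; first exact: measurable_funPTI.
by have := leeD Pb Pz; rewrite adde0.
Unshelve. all: by end_near. Qed.

Local Notation Phi := (normal_prob (0 : R) 1).

Lemma normal_prob_set1 (m s x : R) : normal_prob m s [set x] = 0%E.
Proof.
apply: (@normal_prob_dominates R m s [set x]) => //.
by apply/measure0_null_setP => //; exact: lebesgue_measure_set1.
Qed.

Let measurable_idR : @measurable_fun _ _ (measurableTypeR R) R setT idfun.
Proof. by move=> _ B mB; rewrite setTI preimage_id. Qed.

Let idR : {RV (normal_prob (0 : R) 1) >-> R} := mfun_of measurable_idR.

Let distribution_idR : distribution (normal_prob 0 1) idR = Phi.
Proof. by apply/funext => A; rewrite /distribution/= /pushforward preimage_id. Qed.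

Lemma normal_quantileE (q : R) : 0 < q < 1 ->
  Phi `]-oo, normal_quantile q] = q%:E.
Proof.
move=> q01; have [+ _] := @cdf_quantile _ _ (normal_prob 0 1) idR q q01
  (fun x => normal_prob_set1 0 1 x).
by rewrite distribution_idR.
Qed.

Lemma measurable_normal_cdf : measurable_fun setT (fun x : R => Phi `]-oo, x]).
Proof. by rewrite -distribution_idR; exact: (cdf_measurable idR). Qed.

Lemma normal_quantile_le (q y : R) : 0 < q < 1 ->
  (q%:E <= Phi `]-oo, y])%E = (normal_quantile q <= y).
Proof.
move=> q01; apply/idP/idP => [|qy].
  have [_] := @cdf_quantile _ _ (normal_prob 0 1) idR q q01
    (fun x => normal_prob_set1 0 1 x).
  by rewrite distribution_idR; apply.
rewrite -(normal_quantileE q01); apply: le_measure; rewrite ?inE//.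
by move=> x /=; rewrite !in_itv/= => /le_trans; apply.
Qed.

Let measurable_normR : @measurable_fun _ _ (measurableTypeR R) R setT (fun x => `|x|).
Proof. by apply: continuous_measurable_fun; exact: norm_continuous. Qed.

(** The number [t] is the [a]-quantile of the absolute value of a standard normal variable. It is
    not negative, since the interval would then be empty and have probability 0 instead of [a]. *)
Lemma normal_prob_centered_itv_exists (a : R) : 0 < a < 1 ->
  exists2 t, 0 <= t & Phi `[(- t)%R, t] = a%:E.
Proof.
move=> a01; have /andP[a0 a1] := a01.
pose N : {RV (normal_prob (0 : R) 1) >-> R} := mfun_of measurable_normR.
have atomless x : normal_prob 0 1 (N @^-1` [set x]) = 0%E.
  have ms (y : R) : measurable [set y] by exact: measurable_set1.
  have := measureU2 (normal_prob (0 : R) 1) (ms x) (ms (- x)).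
  have -> : (normal_prob (0 : R) 1 [set x] + normal_prob (0 : R) 1 [set (- x)%R] = 0)%E.
    by rewrite !normal_prob_set1 adde0.
  move=> h; apply/eqP; rewrite eq_le measure_ge0 andbT; apply: le_trans h.
  apply: le_measure; rewrite ?inE.
  - exact: (@measurable_preimage _ _ _ _ _ _ measurable_normR (ms x)).
  - exact: measurableU.
  move=> y /= <-; have [y0|y0] := leP 0 y; first by left; rewrite ger0_norm.
  by right; rewrite ltr0_norm ?opprK.
have [+ _] := cdf_quantile a01 atomless.
set t := quantile _ _; rewrite /distribution/= /pushforward => e.
have E : N @^-1` `]-oo, t] = `[(- t)%R, t]%classic.
  by apply/seteqP; split => x /=; rewrite !in_itv/= ler_norml.
exists t; last by rewrite -e E.
rewrite leNgt; apply/negP => t0; move: e; rewrite E set_itv_ge.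
  by rewrite measure0 => -[] /eqP; rewrite lt_eqF.
by rewrite bnd_simp -ltNge; lra.
Qed.

End quantiles.

(** * Marginal laws of the noise, second moments, almost sure convergence *)

Section noise.
Context (R : realType) (H : completeNormedModType R) (ip : {dot H for idfun}).
Hypothesis ip_norm : forall h : H, ip h h = `|h| ^+ 2.
Context d (T : measurableType d) (P : probability T R) (eps : H -> {RV P >-> R}).
Hypothesis eps_gaussian : standard_gaussian eps.
Local Notation mu := (@lebesgue_measure R).

Lemma noise_normalized (h : H) : h != 0 ->
  {ae P, forall w, eps h w = `|h| * eps (`|h|^-1 *: h) w}.
Proof.
move=> h0; apply: filterS (noise_scale eps_gaussian `|h|^-1 h) => w ->.
by rewrite mulrA divff ?mul1r// normr_eq0.
Qed.

Lemma norm_normalized (h : H) : h != 0 -> `| `|h|^-1 *: h| = 1.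
Proof. by move=> h0; rewrite normrZ normfV normr_id mulVf// normr_eq0. Qed.

Lemma unit_noise_law (u : H) (B : set R) : `|u| = 1 -> measurable B ->
  P [set w | B (eps u w)] = normal_prob 0 1 B.
Proof.
move=> u1 mB; rewrite (noise_law eps_gaussian _ mB) ?u1//.
by rewrite -normr_gt0 u1.
Qed.

Lemma noise_affine_law (h : H) (m c : R) (B : set R) : h != 0 -> measurable B ->
  P [set w | B (m + c * eps h w)] = normal_prob 0 1 [set x | B (m + c * `|h| * x)].
Proof.
move=> h0 mB.
have mB' (a : R) : measurable [set x | B (m + a * x)].
  apply: (@measurable_preimage _ _ _ _ (fun x : R => m + a * x)) mB.
  by apply: measurable_funD => //; exact: measurable_funM.
rewrite -(unit_noise_law (norm_normalized h0) (mB' _)).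
apply: ae_eq_measure.
- exact: (@measurable_preimage _ _ _ _ _ _ (measurable_noise eps h) (mB' c)).
- exact: (@measurable_preimage _ _ _ _ _ _ (measurable_noise eps (`|h|^-1 *: h)) (mB' (c * `|h|))).
- by apply: filterS (noise_normalized h0) => w /= ->; rewrite mulrA.
Qed.

Lemma inf_ray (m : R) : inf [set x | m <= x] = m.
Proof.
apply/eqP; rewrite eq_le; apply/andP; split.
  by apply: ge_inf; [exists m|exact: lexx].
by apply: lb_le_inf; [exists m; exact: lexx|].
Qed.

Lemma quantile_affine_noise (h : H) (m c q : R) : h != 0 -> 0 < c -> 0 < q < 1 ->
  quantile (pushforward P (fun w => m + c * eps h w)) q =
  m + c * `|h| * normal_quantile q.
Proof.
move=> h0 c0 q01; have ch0 : 0 < c * `|h| by rewrite mulr_gt0// normr_gt0.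
rewrite -[RHS](inf_ray (m + c * `|h| * normal_quantile q)) /quantile.
congr inf; apply/funext => x /=; rewrite /pushforward/=.
rewrite -[P _]/(P [set w | `]-oo, x]%classic (m + c * eps h w)]) noise_affine_law//.
rewrite [X in (_ <= normal_prob _ _ X)%E](_ : _ = `]-oo, (x - m) / (c * `|h|)]%classic).
  by rewrite normal_quantile_le// ler_pdivlMr// lerBrDl mulrC.
by apply/seteqP; split => y /=; rewrite !in_itv/= ler_pdivlMr// lerBrDl mulrC.
Qed.

Lemma quantile_const_noise (m c q : R) : 0 < q < 1 ->
  quantile (pushforward P (fun w => m + c * eps 0 w)) q = m.
Proof.
move=> /andP[q0 q1]; rewrite -[RHS](inf_ray m) /quantile; congr inf.
apply/funext => x /=; rewrite /pushforward/=.
have mB : measurable [set w | `]-oo, x]%classic (m + c * eps 0 w)].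
  apply: (@measurable_preimage _ _ _ _ (fun w => m + c * eps 0 w)) => //.
  by apply: measurable_funD => //; exact: measurable_funM.
rewrite -[P _]/(P [set w | `]-oo, x]%classic (m + c * eps 0 w)]).
have [mx|mx] := leP m x.
  have -> : P [set w | `]-oo, x]%classic (m + c * eps 0 w)] = P setT.
    apply: (@ae_eq_measure _ T R P _ _ mB measurableT).
    apply: filterS (noise_zero eps_gaussian) => w /= ->.
    by rewrite mulr0 addr0 in_itv/= mx.
  by rewrite probability_setT lee_fin ltW.
have -> : P [set w | `]-oo, x]%classic (m + c * eps 0 w)] = P set0.
  apply: (@ae_eq_measure _ T R P _ _ mB measurable0).
  apply: filterS (noise_zero eps_gaussian) => w /= ->.
  by rewrite mulr0 addr0 in_itv/= leNgt mx.
by rewrite measure0 lee_fin leNgt q0.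
Qed.

Lemma normal_second_moment_lty :
  (\int[normal_prob (0 : R) 1]_x (x ^+ 2)%:E < +oo)%E.
Proof.
have mx2 : measurable_fun setT (fun x : R => (x ^+ 2)%:E).
  by apply/measurable_EFinP; exact: measurable_funX.
have -> := integral_normal_prob 0 1 mx2 (fun x => sqr_ge0 x).
(* The exponents of the densities of N(0, 1) and N(0, 4) differ by [x ^+ 2 * (3 / 8)], and [x ^+ 2
   <= 8 / 3 * expR (x ^+ 2 * (3 / 8))]; hence the factor 8 / 3, next to the ratio of the peaks. *)
pose c : R := 8 / 3 * (normal_peak 1 / normal_peak 2).
have one0 : (1 : R) != 0 by exact: oner_neq0.
have two0 : (2 : R) != 0 by [].
have mpdf s : measurable_fun setT (fun x : R => (normal_pdf 0 s x)%:E).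
  by apply/measurable_EFinP; exact: measurable_normal_pdf.
apply: (@le_lt_trans _ _ (\int[mu]_x (c%:E * (normal_pdf 0 2 x)%:E))%E); last first.
  rewrite ge0_integralZl//.
  - by rewrite integral_normal_pdf mule1 ltry.
  - exact: mpdf.
  - by move=> x _; rewrite lee_fin normal_pdf_ge0.
  - by rewrite lee_fin /c mulr_ge0// divr_ge0// normal_peak_ge0.
apply: ge0_le_integral => //.
- by move=> x _; rewrite -EFinM lee_fin mulr_ge0 ?sqr_ge0 ?normal_pdf_ge0.
- by apply: emeasurable_funM => //; exact: mpdf.
- by apply: emeasurable_funM => //; exact: mpdf.
move=> x _; rewrite -!EFinM lee_fin (normal_pdf0E _ _ one0) (normal_pdf0E _ _ two0).
have p1 := normal_peak_gt0 one0; have p2 := normal_peak_gt0 two0.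
rewrite /c; set A := normal_peak 1 in p1 *; set B := normal_peak 2 in p2 *.
have -> : 8 / 3 * (A / B) * (B * normal_fun 0 2 x) = A * (8 / 3 * normal_fun 0 2 x).
  by field; rewrite gt_eqF.
rewrite mulrCA ler_pM2l//.
have -> : normal_fun 0 1 x = normal_fun 0 2 x * expR (- (x ^+ 2 * (3 / 8))).
  by rewrite /normal_fun -expRD; congr expR; field.
rewrite mulrCA mulrC ler_wpM2r ?normal_fun_ge0//.
rewrite expRN ler_pdivrMr ?expR_gt0//.
have := expR_ge1Dx (x ^+ 2 * (3 / 8)); lra.
Qed.

Lemma noise_second_moment (h : H) :
  (\int[P]_w ((eps h w) ^+ 2)%:E =
   (`|h| ^+ 2)%:E * \int[normal_prob (0 : R) 1]_x (x ^+ 2)%:E)%E.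
Proof.
have msq k : measurable_fun setT (fun w => ((eps k w) ^+ 2)%:E).
  by apply/measurable_EFinP; exact: measurable_funX.
have [->|h0] := eqVneq h 0.
  rewrite normr0 expr0n/= mul0e; rewrite -[RHS](integral0 P setT).
  apply: ae_eq_integral => //.
  by apply: filterS (noise_zero eps_gaussian) => w /= -> _; rewrite expr0n.
set u := `|h|^-1 *: h.
transitivity (\int[P]_w ((`|h| ^+ 2)%:E * ((eps u w) ^+ 2)%:E))%E.
  apply: ae_eq_integral => //; first exact: emeasurable_funM.
  by apply: filterS (noise_normalized h0) => w /= -> _; rewrite -EFinM exprMn.
have f0 (w : T) : setT w -> (0 <= ((eps u w) ^+ 2)%:E)%E by rewrite lee_fin sqr_ge0.
have k0 : (0 <= (`|h| ^+ 2)%:E)%E by rewrite lee_fin sqr_ge0.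
rewrite (ge0_integralZl P measurableT (msq u) f0 k0).
congr (_ * _)%E.
have mx2 : measurable_fun setT (fun x : R => (x ^+ 2)%:E).
  by apply/measurable_EFinP; exact: measurable_funX.
have mu' : @measurable_fun _ _ T (measurableTypeR R) setT (eps u).
  by move=> _ B mB; exact: (measurable_noise eps u measurableT mB).
have x20 (x : R) : x \in setT -> (0 <= (x ^+ 2)%:E)%E by rewrite lee_fin sqr_ge0.
have := @ge0_integral_pushforward _ _ _ (measurableTypeR R) _ _ mu' P setT _ measurableT mx2 x20.
rewrite preimage_setT => <-.
apply: eq_measure_integral => A mA _.
exact: (unit_noise_law (norm_normalized h0) mA).
Qed.

Lemma sqr_cvg0 (u : nat -> R) : (fun n => u n ^+ 2) @ \oo --> (0 : R) -> u @ \oo --> (0 : R).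
Proof.
move=> /cvgr0Pnorm_le h; apply/cvgr0Pnorm_le => e e0; near=> n.
have : `|u n ^+ 2| <= e ^+ 2 by near: n; apply: h; rewrite exprn_gt0.
by rewrite normrX ler_sqr// nnegrE// ltW.
Unshelve. all: by end_near. Qed.

Lemma nneseries_lty_cvg0 (a : nat -> R) : (forall n, 0 <= a n) ->
  (\sum_(0 <= n <oo) (a n)%:E < +oo)%E -> a @ \oo --> (0 : R).
Proof.
move=> a0 afin; apply: cvg_series_cvg_0.
have afin' : (\sum_(0 <= n <oo) (a n)%:E)%E \is a fin_num.
  by rewrite ge0_fin_numE//; apply: nneseries_ge0 => n _ _; rewrite lee_fin.
apply: nondecreasing_is_cvgn.
  by apply/nondecreasing_seqP => n; rewrite /series/= big_nat_recr//= lerDl.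
exists (fine (\sum_(0 <= n <oo) (a n)%:E)%E) => _ [n _ <-].
rewrite -lee_fin fineK// /series/= -sumEFin.
by apply: nneseries_lim_ge => k _ _; rewrite lee_fin.
Qed.

(** The second moments of [eps (r n)] are summable, so the sum of the squares is integrable, hence
    almost surely finite, and its terms tend to 0. *)
Lemma noise_cvg0 (r : nat -> H) (C : R) : 0 <= C ->
  (forall n, `|r n| ^+ 2 <= C / 2 ^+ n.+1) ->
  {ae P, forall w, eps (r n) w @[n --> \oo] --> (0 : R)}.
Proof.
move=> C0 rC; set M := (\int[normal_prob (0 : R) 1]_x (x ^+ 2)%:E)%E.
have M0 : (0 <= M)%E by apply: integral_ge0 => x _; rewrite lee_fin sqr_ge0.
have Mfin : M \is a fin_num by rewrite ge0_fin_numE//; exact: normal_second_moment_lty.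
pose f n w := ((eps (r n) w) ^+ 2)%:E.
have mf n : measurable_fun setT (f n).
  by apply/measurable_EFinP; exact: measurable_funX.
have f0 n w : setT w -> (0 <= f n w)%E by move=> _; rewrite lee_fin sqr_ge0.
have mS : measurable_fun setT (fun w => \sum_(0 <= n <oo) f n w)%E.
  by apply: (@ge0_emeasurable_sum _ _ _ setT f xpredT) => [k w _ _|k _]; [exact: f0|exact: mf].
have : P.-integrable setT (fun w => \sum_(0 <= n <oo) f n w)%E.
  apply/integrableP; split => //.
  rewrite (eq_integral (fun w => \sum_(0 <= n <oo) f n w)%E); last first.
    by move=> w _; rewrite gee0_abs//; apply: nneseries_ge0 => n _ _; exact: f0.
  rewrite (integral_nneseries P measurableT mf f0).
  apply: (@le_lt_trans _ _ (\sum_(0 <= n <oo) ((C * fine M) / (2 ^ n.+1)%:R)%:E)%E); last first.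
    apply: le_lt_trans (epsilon_trick0 _ _) _; last exact: ltry.
    by rewrite mulr_ge0// fine_ge0.
  apply: lee_nneseries => n _ => [_|]; first by apply: integral_ge0 => w _; exact: f0.
  have ME : M = (fine M)%:E by rewrite fineK.
  rewrite noise_second_moment -/M {1}ME -EFinM lee_fin natrX [leRHS]mulrAC.
  by apply: ler_wpM2r; [exact: fine_ge0|exact: rC].
move=> /(integrable_ae measurableT); apply: filterS => w /(_ I) Sfin.
have : (fun n => (eps (r n) w) ^+ 2) @ \oo --> (0 : R).
  apply: nneseries_lty_cvg0 => [n|]; first exact: sqr_ge0.
  by rewrite -ge0_fin_numE//; apply: nneseries_ge0 => n _ _; exact: (f0 n w I).
exact: sqr_cvg0.
Qed.

End noise.

(** * Constrained minimizers and the distance as a function of the level *)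

Section convex_projection.
Context (R : realType) (V : lmodType R) (H : completeNormedModType R)
  (ip : {dot H for idfun}).
Hypothesis ip_norm : forall h : H, ip h h = `|h| ^+ 2.
Context (F : set V) (K : {linear V -> H}) (L : {scalar V}) (g : V) (fmin : R -> V).
Hypothesis F_convex : convex_set F.
Hypothesis Fg : F g.
Hypothesis fminP : forall l, is_constrained_minimizer F K L g l (fmin l).
Local Notation mu := (@lebesgue_measure R).

Lemma convex_mem (x y : V) (t : R) : F x -> F y -> 0 <= t -> t <= 1 ->
  F (t *: x + (1 - t) *: y).
Proof.
move=> Fx Fy t0 t1.
have := F_convex (Itv01 t0 t1) (mem_set Fx) (mem_set Fy).
by rewrite inE.
Qed.

Definition gap (l : R) : H := K (g - fmin l).
Definition dist (l : R) : R := `|gap l|.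

Lemma dist_min f : F f -> dist (L f) <= `|K (g - f)|.
Proof. by move=> Ff; have [_ _] := fminP (L f); apply. Qed.

Lemma Ffmin l : F (fmin l). Proof. by have [] := fminP l. Qed.
Lemma Lfmin l : L (fmin l) = l. Proof. by have [] := fminP l. Qed.

Lemma dist_ge0 l : 0 <= dist l. Proof. exact: normr_ge0. Qed.

Lemma dist_Lg : dist (L g) = 0.
Proof.
apply/eqP; rewrite eq_le dist_ge0 andbT; apply: le_trans (dist_min Fg) _.
by rewrite subrr linear0 normr0.
Qed.

Lemma sqr_normD (x y : H) : `|x + y| ^+ 2 = `|x| ^+ 2 + 2 * ip x y + `|y| ^+ 2.
Proof.
by rewrite -!ip_norm linearDl !linearDr/= (ipC ip y x); ring.
Qed.

Lemma sqr_normZ (a : R) (x : H) : `|a *: x| ^+ 2 = a ^+ 2 * `|x| ^+ 2.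
Proof. by rewrite normrZ exprMn real_normK// num_real. Qed.

(** Cauchy-Schwarz, from the nonnegative squared norm of the multiple of [x] by the squared norm of
    [y], minus [ip x y *: y]. *)
Lemma ip_bound (x y : H) : `|ip x y| <= `|x| * `|y|.
Proof.
have [->|y0] := eqVneq y 0; first by rewrite linear0r normr0 normr0 mulr0.
have ny : 0 < `|y| ^+ 2 by rewrite exprn_gt0// normr_gt0.
have := sqr_ge0 `| (`|y| ^+ 2) *: x + (- ip x y) *: y|.
rewrite sqr_normD !sqr_normZ ipZr ipZl.
rewrite -(ler_sqr (x := `|ip x y|)) ?nnegrE ?mulr_ge0// real_normK ?num_real// exprMn.
set a := ip x y; set b := `|x| ^+ 2; set c := `|y| ^+ 2 in ny *.
rewrite (_ : _ + _ = c * (b * c - a ^+ 2)); last by ring.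
by rewrite exprMn pmulr_rge0// subr_ge0.
Qed.

Lemma gap_dist s t : `|dist s - dist t| <= `|gap s - gap t|.
Proof. exact: ler_dist_dist. Qed.

Lemma gap_sub l : K (fmin l) = K g - gap l.
Proof. by rewrite /gap linearB subKr. Qed.

(** The variational inequality of a projection: if it failed, a small move from the minimizer
    towards [f], which stays in [F] at level [L f], would shorten the gap. *)
Lemma projection_le f : F f -> ip (K f) (gap (L f)) <= ip (K (fmin (L f))) (gap (L f)).
Proof.
move=> Ff; set l := L f; set k := gap l.
rewrite -subr_le0 -[_ - _]linearBl/= -linearB/=; set v := K (f - fmin l).
rewrite leNgt; apply/negP => c0; set c := ip v k in c0.
have n0 : 0 <= `|v| ^+ 2 by exact: sqr_ge0.
(* With [n] the squared norm of [v], this choice gives [t * n < c], so the squared norm of the gap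
   changes by [- 2 * t * c + t ^+ 2 * n < 0]. *)
pose t := c / (c + `|v| ^+ 2).
have cn : 0 < c + `|v| ^+ 2 by rewrite ltr_pwDl.
have t0 : 0 < t by rewrite divr_gt0.
have t1 : t <= 1 by rewrite ler_pdivrMr// mul1r lerDl.
pose f' := t *: f + (1 - t) *: fmin l.
have Ff' : F f' by apply: convex_mem => //; [exact: Ffmin|exact: ltW].
have Lf' : L f' = l.
  have -> : L f' = t * L f + (1 - t) * L (fmin l) by rewrite /f' linearD !linearZ.
  by rewrite Lfmin -/l; ring.
have := dist_min Ff'; rewrite Lf' -/k.
have -> : K (g - f') = k + (- t) *: v.
  rewrite /k /gap /v -linearZ -linearD; congr (K _).
  rewrite /f' scalerBl scale1r addrCA -scalerBr opprD addrA.
  by rewrite scaleNr.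
rewrite -(ler_sqr (x := dist l)) ?nnegrE ?normr_ge0//.
rewrite sqr_normD sqr_normZ ipZr (ipC ip k v) -/c -/(dist l).
have tE : t * (c + `|v| ^+ 2) = c by rewrite divfK// gt_eqF.
rewrite /dist -/k; nra.
Qed.

Lemma gap_combination a b t :
  K (g - (t *: fmin a + (1 - t) *: fmin b)) = t *: gap a + (1 - t) *: gap b.
Proof.
rewrite /gap -!linearZ -linearD; congr (K _).
have {1}-> : g = t *: g + (1 - t) *: g by rewrite -scalerDl subrKC scale1r.
by rewrite opprD addrACA -!scalerBr.
Qed.

(** The convex combination of two minimizers is in [F] and has the combined level. *)
Lemma dist_convex a b t : 0 <= t -> t <= 1 ->
  dist (t * a + (1 - t) * b) <= t * dist a + (1 - t) * dist b.
Proof.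
move=> t0 t1.
have Ff' := convex_mem (Ffmin a) (Ffmin b) t0 t1.
have := dist_min Ff'; rewrite linearD !linearZ/= !Lfmin => /le_trans; apply.
rewrite gap_combination.
rewrite (le_trans (ler_normD _ _))// !normrZ (ger0_norm t0) ger0_norm ?subr_ge0//.
Qed.

(** The parallelogram law; half the sum of the two gaps is the gap of the midpoint of the
    minimizers, whose norm is at least [dist ((s + t) / 2)]. *)
Lemma gap_parallelogram s t :
  `|gap s - gap t| ^+ 2 <= 2 * dist s ^+ 2 + 2 * dist t ^+ 2 - 4 * dist ((s + t) / 2) ^+ 2.
Proof.
have h2 : (0 : R) <= 2^-1 by lra.
have h21 : 2^-1 <= (1 : R) by lra.
have Ff' := convex_mem (Ffmin s) (Ffmin t) h2 h21.
have Le : L (2^-1 *: fmin s + (1 - 2^-1) *: fmin t) = (s + t) / 2.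
  by rewrite linearD !linearZ/= !Lfmin; field.
have := dist_min Ff'; rewrite Le.
have -> : K (g - (2^-1 *: fmin s + (1 - 2^-1) *: fmin t)) = 2^-1 *: (gap s + gap t).
  by rewrite gap_combination (_ : 1 - 2^-1 = 2^-1 :> R) ?scalerDr//; field.
rewrite -ler_sqr ?nnegrE ?normr_ge0 ?dist_ge0//. rewrite sqr_normZ.
have -> : gap s - gap t = gap s + (-1) *: gap t by rewrite scaleN1r.
rewrite !sqr_normD sqr_normZ ipZr -/(dist s) -/(dist t).
rewrite (_ : (2^-1) ^+ 2 = 4^-1 :> R); last by field.
rewrite (_ : (-1) ^+ 2 = 1 :> R); last by ring.
move: (ip _ _) => c h. lra.
Qed.

(** A convex function with values between 0 and [D] is Lipschitz at unit distance from the ends of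
    the region: each chord is compared with its extension by 1 on either side. *)
Lemma dist_lipschitz D l s t : (forall x, `|x - l| <= 2 -> dist x <= D) ->
  `|s - l| <= 1 -> `|t - l| <= 1 -> `|dist s - dist t| <= D * `|s - t|.
Proof.
move=> HD.
have D0 : 0 <= D by apply: le_trans (HD l _); rewrite ?dist_ge0// subrr normr0.
wlog st : s t / s <= t.
  move=> wl hs ht; have [st|/ltW st] := leP s t; first exact: wl.
  by rewrite distrC (distrC s); exact: wl.
move=> /ler_normlP[s1 s2] /ler_normlP[t1 t2].
have rD : 0 < t - s + 1 by rewrite ltr_wpDl// subr_ge0.
(* The weight that places [t] between [s] and [t + 1], and also [s] between [t] and [s - 1]. *)
pose th := (t - s) / (t - s + 1).
have th0 : 0 <= th by rewrite divr_ge0 ?subr_ge0// ltW.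
have th1 : th <= 1 by rewrite ler_pdivrMr// mul1r lerDl.
have thst : th <= t - s by rewrite ler_pdivrMr// ler_peMr ?subr_ge0// lerDr subr_ge0.
have e1 : dist t <= th * dist (t + 1) + (1 - th) * dist s.
  rewrite [X in dist X](_ : t = th * (t + 1) + (1 - th) * s); first exact: dist_convex.
  by rewrite /th; field; rewrite gt_eqF.
have e2 : dist s <= th * dist (s - 1) + (1 - th) * dist t.
  rewrite [X in dist X](_ : s = th * (s - 1) + (1 - th) * t); first exact: dist_convex.
  by rewrite /th; field; rewrite gt_eqF.
have b1 : dist (t + 1) <= D by apply: HD; apply/ler_normlP; split; lra.
have b2 : dist (s - 1) <= D by apply: HD; apply/ler_normlP; split; lra.
have := dist_ge0 s; have := dist_ge0 t => dt ds.
rewrite (distrC s) (ger0_norm (x := t - s)) ?subr_ge0//.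
by apply/ler_normlP; split; nra.
Qed.

(** The bound of [gap_parallelogram] is a combination of differences of squares of [dist] at [s],
    [l] and their midpoint, and [dist] is Lipschitz near [l]. *)
Lemma gap_holder l : exists2 C, 0 <= C & forall s, `|s - l| <= 1 ->
  `|gap s - gap l| ^+ 2 <= C * `|s - l|.
Proof.
pose D := dist (l - 2) + dist (l + 2).
have HD x : `|x - l| <= 2 -> dist x <= D.
  rewrite ler_distl => /andP[x1 x2].
  pose t := (x - (l - 2)) / 4.
  have t0 : 0 <= t by rewrite /t; lra.
  have t1 : t <= 1 by rewrite /t; lra.
  rewrite [x in dist x](_ : x = t * (l + 2) + (1 - t) * (l - 2)); last by rewrite /t; field.
  apply: le_trans (dist_convex _ _ t0 t1) _; rewrite /D.
  have := dist_ge0 (l - 2); have := dist_ge0 (l + 2); nra.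
have D0 : 0 <= D by rewrite addr_ge0 ?dist_ge0.
(* Each of the two differences of squares is at most [D / 2] times the distance from [s] to [l],
   times a sum of at most [2 * D]; each one carries the coefficient 2. *)
exists (4 * D ^+ 2); first by rewrite mulr_ge0// sqr_ge0.
move=> s sl; apply: le_trans (gap_parallelogram s l) _.
set m := (s + l) / 2.
have sm : s - m = (s - l) / 2 by rewrite /m; field.
have lm : l - m = - ((s - l) / 2) by rewrite /m; field.
have ml : `|m - l| <= 1.
  rewrite distrC lm normrN normrM (ger0_norm (x := 2^-1))//; lra.
have ll : `|l - l| <= 1 by rewrite subrr normr0.
have h1 := dist_lipschitz HD sl ml.
have h2 := dist_lipschitz HD ll ml.
rewrite sm normrM (ger0_norm (x := 2^-1))// in h1.
rewrite lm normrN normrM (ger0_norm (x := 2^-1))// in h2.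
have b x : `|x - l| <= 1 -> 0 <= dist x <= D.
  by move=> xl; rewrite dist_ge0 HD// (le_trans xl)// ler1n.
have /andP[s0 sD] := b _ sl; have /andP[l0 lD] := b _ ll; have /andP[m0 mD] := b _ ml.
move: h1 h2; rewrite !ler_norml => /andP[_ h1] /andP[_ h2].
have n0 : 0 <= `|s - l| by [].
have -> : 2 * dist s ^+ 2 + 2 * dist l ^+ 2 - 4 * dist m ^+ 2 =
  2 * ((dist s - dist m) * (dist s + dist m)) + 2 * ((dist l - dist m) * (dist l + dist m)).
  by ring.
have k (x y : R) : 0 <= x <= D -> 0 <= y <= D -> x - y <= D * (`|s - l| / 2) ->
    (x - y) * (x + y) <= D ^+ 2 * `|s - l|.
  move=> /andP[x0 xD] /andP[y0 yD] xy.
  apply: le_trans (_ : D * (`|s - l| / 2) * (x + y) <= _).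
    by rewrite ler_wpM2r// addr_ge0.
  have : 0 <= D * `|s - l| by rewrite mulr_ge0.
  nra.
have := k _ _ (introT andP (conj s0 sD)) (introT andP (conj m0 mD)) h1.
have := k _ _ (introT andP (conj l0 lD)) (introT andP (conj m0 mD)) h2.
lra.
Qed.

Lemma sublevel_interval t : is_interval [set l | dist l <= t].
Proof.
move=> x y /= xt yt z /andP[xz zy].
have [xy|] := ltP x y; last first.
  by move=> yx; have -> : z = x by apply/eqP; rewrite eq_le xz (le_trans zy).
pose th := (z - y) / (x - y).
have xy0 : y - x != 0 by rewrite subr_eq0 gt_eqF.
have xy0' : x - y != 0 by rewrite subr_eq0 lt_eqF.
have th' : th = (y - z) / (y - x) by rewrite /th; field; rewrite xy0 xy0'.
have th0 : 0 <= th by rewrite th' divr_ge0 ?subr_ge0// ltW.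
have th1 : th <= 1 by rewrite th' ler_pdivrMr ?subr_gt0// mul1r lerD2l lerN2.
rewrite (_ : z = th * x + (1 - th) * y); last by rewrite /th; field.
apply: le_trans (dist_convex _ _ th0 th1) _.
nra.
Qed.

Lemma measurable_dist : measurable_fun setT dist.
Proof.
apply: (measurability (@RGenOInfty.G R)); first exact: RGenOInfty.measurableE.
move=> _ [_ [x ->] <-]; rewrite setTI.
rewrite (_ : _ @^-1` _ = ~` [set l | dist l <= x]).
  by apply: measurableC; apply: is_interval_measurable; exact: sublevel_interval.
by apply/seteqP; split => l /=; rewrite in_itv/= andbT ltNge => /negP.
Qed.

(** The two suprema are the lengths of the parts of [S] to the left and to the right of [c],
    possibly infinite. The upper bound encloses [S] in a segment, the lower bound uses segments
    between points of [S]. *)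
Lemma interval_measure (S : set R) (c : R) : is_interval S -> S c ->
  mu S = (ereal_sup [set (c - l)%:E | l in S] + ereal_sup [set (l - c)%:E | l in S])%E.
Proof.
move=> iS Sc; have mS := is_interval_measurable iS.
set A := ereal_sup _; set B := ereal_sup _.
have A0 : (0 <= A)%E by apply: ereal_sup_ubound; exists c; rewrite ?subrr.
have B0 : (0 <= B)%E by apply: ereal_sup_ubound; exists c; rewrite ?subrr.
have ub l1 l2 : S l1 -> S l2 -> ((c - l1)%:E + (l2 - c)%:E <= mu S)%E.
  move=> S1 S2; rewrite -EFinD (_ : c - l1 + (l2 - c) = l2 - l1); last by ring.
  have [l12|l21] := ltP l1 l2; last first.
    by apply: (@le_trans _ _ 0%E); rewrite ?lee_fin ?subr_le0.
  have -> : (l2 - l1)%:E = mu `[l1, l2] by rewrite lebesgue_measure_itv/= lte_fin l12 EFinB.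
  apply: le_measure; rewrite ?inE; [exact: measurable_itv|exact: mS|].
  by move=> x /=; rewrite in_itv/= => x12; exact: (iS _ _ S1 S2).
apply/eqP; rewrite eq_le; apply/andP; split.
  have [Afin|Ainf] := boolP (A \is a fin_num); last first.
    move: Ainf; rewrite ge0_fin_numE// -leNgt leye_eq => /eqP ->.
    by rewrite addye ?leey// gt_eqF// (lt_le_trans _ B0)// ltNy0.
  have [Bfin|Binf] := boolP (B \is a fin_num); last first.
    move: Binf; rewrite ge0_fin_numE// -leNgt leye_eq => /eqP ->.
    by rewrite addey ?leey// gt_eqF// (lt_le_trans _ A0)// ltNy0.
  rewrite -(fineK Afin) -(fineK Bfin) -EFinD.
  set a := fine A; set b := fine B.
  have a0 : 0 <= a by exact: fine_ge0.
  have b0 : 0 <= b by exact: fine_ge0.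
  apply: (@le_trans _ _ (mu `[c - a, c + b])).
    apply: le_measure; rewrite ?inE; [exact: mS|exact: measurable_itv|].
    move=> l Sl /=; rewrite in_itv/= lerBlDr -lerBlDl -lerBlDl.
    rewrite -!lee_fin (fineK Afin) (fineK Bfin).
    by apply/andP; split; apply: ereal_sup_ubound; exists l.
  rewrite lebesgue_measure_itv/=; case: ifP => _; last by rewrite lee_fin addr_ge0.
  by rewrite -?EFinD -?EFinB -?EFinD ?lee_fin; lra.
have [Mfin|Minf] := boolP (mu S \is a fin_num); last first.
  by move: Minf; rewrite ge0_fin_numE// -leNgt leye_eq => /eqP ->; rewrite leey.
(* The two suprema are taken one after the other, the right point being held fixed first; finiteness
   of [mu S] justifies the subtraction. *)
have step l2 : S l2 -> (A <= mu S - (l2 - c)%:E)%E.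
  move=> S2; apply: ge_ereal_sup => _ [l1 S1 <-].
  by rewrite leeBrDr//; exact: ub.
have Afin : A \is a fin_num.
  rewrite ge0_fin_numE//; apply: le_lt_trans (step c Sc) _.
  by rewrite subrr sube0 -ge0_fin_numE.
rewrite addeC -leeBrDr//; apply: ge_ereal_sup => _ [l2 S2 <-].
by rewrite leeBrDl// -leeBrDr//; exact: step.
Qed.

(** A level [l] is attained in [F] within distance [t] of [g] exactly when [dist l <= t], so the two
    moduli are the suprema of [L g - l] and [l - L g] over the sublevel set. *)
Lemma sublevel_measure t : 0 <= t ->
  mu [set l | dist l <= t] =
  (modulus K L t F [set g] + modulus K L t [set g] F)%E.
Proof.
move=> t0; rewrite (@interval_measure _ (L g) (@sublevel_interval t)) /=; last by rewrite dist_Lg.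
congr (ereal_sup _ + ereal_sup _)%E; apply/seteqP; split => x /=.
- move=> [l lt <-]; exists (fmin l), g; split => //; first exact: Ffmin.
  by rewrite Lfmin.
- move=> [a [_ [Fa -> ab ->]]]; exists (L a) => //.
  exact: le_trans (dist_min Fa) ab.
- move=> [l lt <-]; exists g, (fmin l); split => //; first exact: Ffmin.
  + by rewrite -opprB linearN normrN.
  + by rewrite Lfmin.
- move=> [_ [b [-> Fb ab ->]]]; exists (L b) => //.
  by apply: le_trans (dist_min Fb) _; rewrite -opprB linearN normrN.
Qed.

End convex_projection.

(** * The tests at each level: critical values and acceptance probabilities *)

Section constrained_gaussian_model.
Context (R : realType) (V : lmodType R) (H : completeNormedModType R)
  (ip : {dot H for idfun}).
Hypothesis ip_norm : forall h : H, ip h h = `|h| ^+ 2.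
Context (F : set V) (K : {linear V -> H}) (L : {scalar V}) (g : V) (fmin : R -> V).
Hypothesis F_convex : convex_set F.
Hypothesis Fg : F g.
Hypothesis fminP : forall l, is_constrained_minimizer F K L g l (fmin l).
Context (sigma : R) (sigma_gt0 : 0 < sigma).
Context d (T : measurableType d) (P : probability T R) (eps : H -> {RV P >-> R}).
Hypothesis eps_gaussian : standard_gaussian eps.
Context (alpha : R) (alpha_gt0 : 0 < alpha) (alpha_lt1 : alpha < 1).
Local Notation obs := (obs_space H R).
Local Notation mu := (@lebesgue_measure R).
Local Notation Phi := (normal_prob (0 : R) 1).
Local Notation k := (gap K g fmin).
Local Notation delta := (dist K g fmin).
Local Notation z := (normal_quantile (1 - alpha)).
Local Notation Y := (observation ip K sigma eps).

Let a01 : 0 < 1 - alpha < 1.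
Proof. by rewrite subr_gt0 alpha_lt1 gtrBl alpha_gt0. Qed.

Definition cutoff (l : R) : R := ip (K (fmin l)) (k l) + sigma * delta l * z.

Definition accept_prob (l : R) : \bar R := Phi `]-oo, z - delta l / sigma].

Lemma measurable_observation f : measurable_fun setT (Y f : T -> obs).
Proof. exact: (@measurable_observe R H ip d T P eps (K f) sigma). Qed.

Lemma gap_neq0 l : (delta l != 0) = (k l != 0).
Proof. by rewrite normr_eq0. Qed.

Lemma statisticE l f w : test_statistic K g (fmin l) (Y f w) = ip (K f) (k l) + sigma * eps (k l) w.
Proof. by []. Qed.

Lemma critical_valueE l : critical_value P Y K alpha g (fmin l) = cutoff l.
Proof.
rewrite /critical_value /cutoff.
have [k0|k0] := eqVneq (k l) 0.
  rewrite /dist k0 normr0 mulr0 mul0r addr0 -[RHS](quantile_const_noise eps_gaussian _ sigma a01).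
  by under eq_fun do rewrite statisticE k0.
rewrite -(quantile_affine_noise eps_gaussian _ k0 sigma_gt0 a01).
by congr quantile.
Qed.

Lemma statistic_tail l f (x : R) : delta l != 0 ->
  P [set w | ip (K f) (k l) + sigma * eps (k l) w <= x] =
  Phi `]-oo, (x - ip (K f) (k l)) / (sigma * delta l)].
Proof.
move=> d0; have k0 : k l != 0 by rewrite -gap_neq0.
have sd : 0 < sigma * delta l by rewrite mulr_gt0// normr_gt0.
rewrite (noise_affine_law eps_gaussian _ _ k0 (B := [set y | y <= x])); last first.
  rewrite (_ : [set y | y <= x] = `]-oo, x]%classic); first exact: measurable_itv.
  by apply/seteqP; split => y; rewrite /= in_itv.
congr (normal_prob _ _ _); apply/seteqP; split => y /=; rewrite in_itv/= ler_pdivlMr// mulrC;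
  by rewrite lerBrDl.
Qed.

Lemma observe_ne l (m : H) (x : R) : delta l != 0 ->
  {ae P, forall w, ip m (k l) + sigma * eps (k l) w != x}.
Proof.
move=> d0; have k0 : k l != 0 by rewrite -gap_neq0.
have sd : sigma * delta l != 0 by rewrite mulf_neq0// gt_eqF.
have mB : measurable [set x] by exact: measurable_set1.
exists [set w | [set x] (ip m (k l) + sigma * eps (k l) w)]; split.
- apply: (@measurable_preimage _ _ _ _ (fun w => ip m (k l) + sigma * eps (k l) w)) => //.
  by apply: measurable_funD => //; exact: measurable_funM.
- rewrite (noise_affine_law eps_gaussian _ _ k0 mB).
  rewrite (_ : [set y | _] = [set (x - ip m (k l)) / (sigma * delta l)]); last first.
    apply/seteqP; split => y /=; first by move=> <-; rewrite addrAC subrr add0r mulrC mulKf.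
    by move=> ->; rewrite mulrC divfK// addrC subrK.
  exact: normal_prob_set1.
- by move=> w /= /negP; rewrite negbK => /eqP.
Qed.

Lemma cutoffE l : cutoff l = ip (K g) (k l) - delta l ^+ 2 + sigma * delta l * z.
Proof. by rewrite /cutoff (gap_sub K g fmin l) linearBl/= ip_norm. Qed.

Lemma accept_g l : delta l != 0 ->
  P [set w | ip (K g) (k l) + sigma * eps (k l) w <= cutoff l] = accept_prob l.
Proof.
move=> d0; rewrite statistic_tail// /accept_prob cutoffE.
rewrite (_ : _ / (sigma * delta l) = z - delta l / sigma)//.
have s0 : sigma != 0 by rewrite gt_eqF.
by field; rewrite d0 s0.
Qed.

(** By [projection_le] the mean of the statistic under [f] is at most its mean under the minimizer
    at the same level, where acceptance has probability exactly [1 - alpha]. *)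
Lemma accept_F f : F f -> delta (L f) != 0 ->
  ((1 - alpha)%:E <= P [set w | (ip (K f) (k (L f)) + sigma * eps (k (L f)) w <= cutoff (L f))%R])%E.
Proof.
move=> Ff d0; rewrite statistic_tail// normal_quantile_le//.
have sd : 0 < sigma * delta (L f) by rewrite mulr_gt0// lt_neqAle eq_sym d0 dist_ge0.
rewrite ler_pdivlMr// mulrC lerBrDl /cutoff lerD2r.
exact: (projection_le ip_norm F_convex fminP).
Qed.

(** * Dyadic approximation of the level and the optimal set *)

Definition dyadic (n : nat) (l : R) : R := (Num.floor (l * 2 ^+ n))%:~R / 2 ^+ n.

(** The bound is [1 / 2 ^+ n], written in the form that [noise_cvg0] asks for. *)
Lemma dyadic_near n l : `|dyadic n l - l| <= 2 / 2 ^+ n.+1.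
Proof.
have p0 : (0 : R) < 2 ^+ n by rewrite exprn_gt0.
have /andP[f1 f2] := floor_itv (l * 2 ^+ n).
rewrite (_ : 2 / 2 ^+ n.+1 = (2 ^+ n)^-1); last by rewrite exprS invfM mulrA divff ?mul1r.
rewrite distrC ger0_norm; last by rewrite subr_ge0 /dyadic ler_pdivrMr.
rewrite -(ler_pM2r p0) mulVf ?gt_eqF// mulrBl /dyadic divfK ?gt_eqF//.
by rewrite lerBlDl; move: f2; rewrite intrD => /ltW.
Qed.

Definition excess (n : nat) (y : obs) (l : R) : R :=
  y (k (dyadic n l)) - cutoff (dyadic n l).

(** In [l] the excess is constant on each dyadic interval, so the set is a countable union of
    measurable rectangles. *)
Lemma measurable_excess n : measurable [set yl : obs * R | excess n yl.1 yl.2 <= 0].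
Proof.
have p0 : (0 : R) < 2 ^+ n by rewrite exprn_gt0.
pose q (j : int) : R := j%:~R / 2 ^+ n.
rewrite (_ : [set yl | _] = \bigcup_(j : int)
  ([set y : obs | y (k (q j)) <= cutoff (q j)] `*` `[q j, q (j + 1)%R[%classic)); last first.
  apply/seteqP; split => [[y l]|[y l]] /=.
    rewrite /excess subr_le0 => e; exists (Num.floor (l * 2 ^+ n)) => //; split => //=.
    have /andP[f1 f2] := floor_itv (l * 2 ^+ n).
    by rewrite in_itv/= /q ler_pdivrMr// ltr_pdivlMr// f1.
  move=> [j _ [/= e]]; rewrite in_itv/= /q ler_pdivrMr// ltr_pdivlMr// => jl.
  by rewrite /excess subr_le0 /dyadic (floor_def jl).
apply: countable_bigcupT_measurable => // j; apply: measurableX => //.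
apply: (@measurable_preimage _ _ _ _ (fun y : obs => y (k (q j))) [set x | x <= cutoff (q j)]).
  exact: measurable_coordinate.
rewrite (_ : [set x | _] = `]-oo, cutoff (q j)]%classic); first exact: measurable_itv.
by apply/seteqP; split => x; rewrite /= in_itv.
Qed.

(** By [gap_holder] the squared norm of [r n] is of order [1 / 2 ^+ n], which is summable, so
    [noise_cvg0] applies to the noise along [r n]; the other terms converge because the gaps do. *)
Lemma excess_cvg (m : H) l :
  {ae P, forall w, excess n (observe ip eps m sigma w) l @[n --> \oo] -->
    observe ip eps m sigma w (k l) - cutoff l}.
Proof.
have [C C0 HC] := gap_holder ip_norm F_convex fminP l.
pose r n : H := k (dyadic n l) - k l.
have near1 n : `|dyadic n l - l| <= 1.
  apply: le_trans (dyadic_near n l) _.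
  by rewrite ler_pdivrMr ?exprn_gt0// mul1r exprS ler_peMr// exprn_ege1// ler1n.
have rC n : `|r n| ^+ 2 <= (2 * C) / 2 ^+ n.+1.
  apply: le_trans (HC _ (near1 n)) _.
  by rewrite (mulrC 2) -mulrA ler_wpM2l// dyadic_near.
have r0 : (fun n => `|r n|) @ \oo --> (0 : R).
  apply: sqr_cvg0; apply: (@squeeze_cvgr _ _ _ _ (fun=> 0) (fun n => (2 * C) / 2 ^+ n.+1)).
  - by near=> n; rewrite sqr_ge0 rC.
  - exact: cvg_cst.
  - have : (fun n => C * (2^-1) ^+ n) @ \oo --> C * (0 : R).
      apply: cvgMr; apply: cvg_expr; rewrite ger0_norm; lra.
    rewrite mulr0; apply: cvg_trans; apply: near_eq_cvg; near=> n.
    rewrite exprVn exprS; field; rewrite expf_neq0//.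
(* There is one null set for each [n]; these countably many sets are discarded together. *)
have lin n : {ae P, forall w, eps (k (dyadic n l)) w = eps (k l) w + eps (r n) w}.
  have := proj1 eps_gaussian 1 (k l) (r n); apply: filterS => w.
  by rewrite scale1r /r subrKC mul1r.
have C20 : 0 <= 2 * C by rewrite mulr_ge0.
apply: filterS2 (ae_foralln lin) (noise_cvg0 eps_gaussian C20 rC) => w linw cw.
have gcv : (fun n => `|delta (dyadic n l) - delta l|) @ \oo --> (0 : R).
  apply: (@squeeze_cvgr _ _ _ _ (fun=> 0) (fun n => `|r n|)) => //; last exact: cvg_cst.
  by near=> n; rewrite normr_ge0/= gap_dist.
have dcv : delta (dyadic n l) @[n --> \oo] --> delta l.
  by apply/subr_cvg0/norm_cvg0P.
have ipcv (m' : H) : ip m' (r n) @[n --> \oo] --> (0 : R).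
  apply/norm_cvg0P; apply: (@squeeze_cvgr _ _ _ _ (fun=> 0) (fun n => `|m'| * `|r n|)).
  - by near=> n; rewrite normr_ge0/= ip_bound.
  - exact: cvg_cst.
  - by rewrite -(mulr0 `|m'|); apply: cvgMr.
have ipE (m' : H) n : ip m' (k (dyadic n l)) = ip m' (k l) + ip m' (r n).
  by rewrite /r linearBr/= subrKC.
have E n : excess n (observe ip eps m sigma w) l =
    (ip m (k l) + ip m (r n)) + sigma * (eps (k l) w + eps (r n) w) -
    (ip (K g) (k l) + ip (K g) (r n) - delta (dyadic n l) ^+ 2 + sigma * delta (dyadic n l) * z).
  by rewrite /excess /observe cutoffE !ipE linw.
under eq_fun do rewrite E.
rewrite (_ : observe _ _ _ _ _ _ - _ =
    (ip m (k l) + 0) + sigma * (eps (k l) w + 0) -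
    (ip (K g) (k l) + 0 - delta l ^+ 2 + sigma * delta l * z)); last first.
  by rewrite /observe cutoffE !addr0.
apply: cvgB; first apply: cvgD.
- by apply: cvgD; [exact: cvg_cst|exact: ipcv].
- by apply: cvgMr; apply: cvgD; [exact: cvg_cst|exact: cw].
apply: cvgD; last by apply: cvgMl; apply: cvgMr.
apply: cvgB; last by apply: cvgM.
by apply: cvgD; [exact: cvg_cst|exact: ipcv].
Unshelve. all: by end_near. Qed.

(** Acceptance requires the excess to be nonpositive from some index on, a condition built from
    countably many measurable ones. Where the gap vanishes, the single event [tie] decides for all
    such [l]. *)
Definition optimal_set (tie : set obs) (y : obs) : set R :=
  [set l | if delta l == 0 then tie y
           else exists N, forall n, (N <= n)%N -> excess n y l <= 0].

Lemma measurable_optimal_set tie : measurable tie ->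
  measurable [set yl : obs * R | optimal_set tie yl.1 yl.2].
Proof.
move=> mtie.
have m0 : measurable [set l : R | delta l == 0].
  rewrite (_ : [set l | _] = [set l | delta l <= 0]).
    by apply: is_interval_measurable; exact: (sublevel_interval F_convex fminP).
  by apply/seteqP; split => l /=; rewrite eq_le dist_ge0 andbT.
rewrite (_ : [set yl | _] = (tie `*` [set l | delta l == 0]) `|`
   ((setT `*` ~` [set l | delta l == 0]) `&`
    \bigcup_N \bigcap_(n in [set n | (N <= n)%N]) [set yl : obs * R | excess n yl.1 yl.2 <= 0])).
  apply: measurableU; first exact: measurableX.
  apply: measurableI; first by apply: measurableX => //; exact: measurableC.
  apply: bigcupT_measurable => N; apply: bigcap_measurable; first by exists N => /=.
  by move=> n _; exact: measurable_excess.
apply/seteqP; split => [[y l]|[y l]]; rewrite /optimal_set /=.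
  case: ifPn => d0; first by left.
  move=> [N HN]; right; split; first by split => //; exact/negP.
  by exists N.
move=> [[ty ->//]|[[_ /negP/negPf ->]]].
by move=> [N _ HN]; exists N.
Qed.

(** The limit of the excess is almost surely nonzero, since the statistic has no atom; the excess is
    then eventually nonpositive exactly when the limit is negative. *)
Lemma optimal_set_ae tie m l : delta l != 0 ->
  {ae P, forall w, optimal_set tie (observe ip eps m sigma w) l <->
    observe ip eps m sigma w (k l) <= cutoff l}.
Proof.
move=> d0.
have ne : {ae P, forall w, ip m (k l) + sigma * eps (k l) w != cutoff l}.
  exact: observe_ne.
apply: filterS2 (excess_cvg m l) ne => w cw new.
rewrite /optimal_set /= (negbTE d0); split.
  move=> [N HN]; rewrite -subr_le0; apply: (cvgr_to_le cw).
  by near=> n; apply: HN; near: n; exact: nbhs_infty_ge.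
rewrite le_eqVlt => /orP[/eqP e|]; first by move: new; rewrite /observe in e *; rewrite e eqxx.
rewrite -subr_lt0 => lt0.
have [N _ HN] := cvgr_lt _ cw _ lt0.
by exists N => n Nn; apply: ltW; exact: HN.
Unshelve. all: by end_near. Qed.

Lemma ysection_measurable (C : obs -> set R) l :
  measurable [set yl : obs * R | C yl.1 yl.2] -> measurable [set y | C y l].
Proof.
move=> mC; have := measurable_ysection l mC.
by rewrite (_ : ysection _ _ = [set y | C y l])//;
  apply/seteqP; split => y; rewrite /ysection/= inE.
Qed.

Lemma accept_measurable l : measurable [set y : obs | y (k l) <= cutoff l].
Proof.
apply: (@measurable_preimage _ _ _ _ (fun y : obs => y (k l)) [set x | x <= cutoff l]).
  exact: measurable_coordinate.
rewrite (_ : [set x | _] = `]-oo, cutoff l]%classic); first exact: measurable_itv.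
by apply/seteqP; split => x; rewrite /= in_itv.
Qed.

Lemma optimal_set_prob tie f l : measurable tie -> delta l != 0 ->
  P [set w | optimal_set tie (Y f w) l] =
  P [set w | ip (K f) (k l) + sigma * eps (k l) w <= cutoff l].
Proof.
move=> mtie d0; apply: ae_eq_measure.
- exact: (measurable_preimage (measurable_observation f)
    (ysection_measurable l (measurable_optimal_set mtie))).
- exact: (measurable_preimage (measurable_observation f) (accept_measurable l)).
- exact: optimal_set_ae.
Qed.

(** * Slices along the gap and the Neyman-Pearson bound *)

Let sigma_neq0 : sigma != 0. Proof. by rewrite gt_eqF. Qed.

Let unit_gap l : H := (delta l)^-1 *: k l.

(** A randomized test on the line: the probability of [A] given the coordinate [x] along the gap.
    With the base point [K (fmin l)], the law of [x] is N(0, 1) under [fmin l], and under [g] it has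
    mean [delta l / sigma] and variance 1. *)
Let slice_accept l (A : set obs) := slice_prob ip eps (K (fmin l)) (unit_gap l) sigma A.

Lemma observation_eq f f' : K f = K f' -> Y f = Y f'.
Proof. by move=> e; apply/funext => w; apply/funext => h; rewrite /observation e. Qed.

Lemma law_fmin l A : delta l != 0 -> measurable A ->
  P [set w | A (Y (fmin l) w)] = (\int[normal_prob 0 1]_x slice_accept l A x)%E.
Proof.
move=> d0 mA.
have u1 : `|unit_gap l| = 1 by apply: norm_normalized; rewrite -gap_neq0.
rewrite -(shift_law ip_norm eps_gaussian (K (fmin l)) sigma 0 u1 mA).
by rewrite mulr0 scale0r addr0.
Qed.

Lemma law_g l A : delta l != 0 -> measurable A ->
  P [set w | A (Y g w)] = (\int[normal_prob (delta l / sigma) 1]_x slice_accept l A x)%E.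
Proof.
move=> d0 mA.
have u1 : `|unit_gap l| = 1 by apply: norm_normalized; rewrite -gap_neq0.
rewrite -(shift_law ip_norm eps_gaussian (K (fmin l)) sigma (delta l / sigma) u1 mA).
rewrite (_ : K (fmin l) + _ = K g)//.
by rewrite mulrC divfK// scalerA divff// scale1r (gap_sub K g fmin l) subrK.
Qed.

Lemma accept_probE l : accept_prob l = normal_prob (delta l / sigma) 1 `]-oo, z].
Proof.
rewrite -{1}(add0r (delta l / sigma)) -(normal_prob_translate 0 _ (oner_neq0 _))//.
congr (normal_prob _ _ _); apply/seteqP; split => x /=; by rewrite !in_itv/= lerBrDr.
Qed.

Lemma accept_prob0 l : delta l = 0 -> accept_prob l = (1 - alpha)%:E.
Proof. by move=> d0; rewrite /accept_prob d0 mul0r subr0 normal_quantileE. Qed.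

Lemma power_bound l A : delta l != 0 -> measurable A ->
  ((1 - alpha)%:E <= P [set w | A (Y (fmin l) w)])%E ->
  (accept_prob l <= P [set w | A (Y g w)])%E /\
  (P [set w | A (Y g w)] = accept_prob l ->
   P [set w | A (Y (fmin l) w)] = (1 - alpha)%:E /\
   {ae mu, forall x, slice_accept l A x = (\1_(`]-oo, z] : set R) x)%:E}).
Proof.
move=> d0 mA; rewrite (law_fmin d0 mA) (law_g d0 mA) accept_probE -(normal_quantileE a01).
apply: neyman_pearson.
- by rewrite divr_gt0// lt_neqAle eq_sym d0 dist_ge0.
- exact: measurable_slice_prob.
- by move=> x; exact: slice_prob_le1.
Qed.

(** Normal densities are positive everywhere, so a nonnegative function with integral 0 vanishes
    almost everywhere for Lebesgue measure. *)
Lemma normal_integral_eq0 (p : R -> \bar R) (m m' : R) : measurable_fun setT p ->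
  (forall x, 0 <= p x)%E ->
  (\int[normal_prob m 1]_x p x = 0)%E -> (\int[normal_prob m' 1]_x p x = 0)%E.
Proof.
move=> mp p0.
have mpdf (a : R) : measurable_fun setT (fun x => (p x * (normal_pdf a 1 x)%:E)%E).
  by apply: emeasurable_funM => //; apply/measurable_EFinP; exact: measurable_normal_pdf.
have -> := integral_normal_prob m 1 mp p0.
have -> := integral_normal_prob m' 1 mp p0.
move=> e0.
have : (\int[mu]_x `|p x * (normal_pdf m 1 x)%:E| = 0)%E.
  rewrite -[RHS]e0; apply: eq_integral => x _.
  by rewrite gee0_abs// mule_ge0// lee_fin normal_pdf_ge0.
move=> /(ae_eq_integral_abs mu measurableT (mpdf m)) pm0.
rewrite -[RHS](integral0 mu setT).
apply: ae_eq_integral; [exact: measurableT|exact: mpdf|exact: measurable_cst|].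
apply: filterS pm0 => x /(_ I)/eqP; rewrite mule_eq0 eqe (gt_eqF (normal_pdf_gt0 m x)) orbF.
by move=> /eqP -> _; rewrite mul0e.
Qed.

(** Sliced along the direction from [m] to [m'], the two laws mix the same slices with two normal
    laws that have the same null sets. *)
Lemma observe_absolutely_continuous (m m' : H) A : measurable A ->
  P [set w | A (observe ip eps m sigma w)] = 0%E ->
  P [set w | A (observe ip eps m' sigma w)] = 0%E.
Proof.
move=> mA; have [->//|mm] := eqVneq m' m.
have h0 : m' - m != 0 by rewrite subr_eq0.
have u1 := norm_normalized h0.
have law1 := shift_law ip_norm eps_gaussian m sigma 0 u1 mA.
have law2 := shift_law ip_norm eps_gaussian m sigma (`|m' - m| / sigma) u1 mA.
rewrite mulr0 scale0r addr0 in law1.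
rewrite mulrC divfK// scalerA divff ?normr_eq0// scale1r addrC subrK in law2.
rewrite law1 law2.
apply: normal_integral_eq0 => //; exact: measurable_slice_prob.
Qed.

(** The event [B] is that [A] contradicts the test. Its slices vanish for almost every [x], so it is
    null under [fmin l], and by absolute continuity under every [f]. *)
Lemma inverts_of_slices l A f : delta l != 0 -> measurable A ->
  {ae mu, forall x, slice_accept l A x = (\1_(`]-oo, z] : set R) x)%:E} ->
  {ae P, forall w, (cutoff l < Y f w (k l) -> ~ A (Y f w)) /\
                   (Y f w (k l) < cutoff l -> A (Y f w))}.
Proof.
move=> d0 mA Aae.
have sd : 0 < sigma * delta l by rewrite mulr_gt0// lt_neqAle eq_sym d0 dist_ge0.
pose hi : set obs := [set y | cutoff l < y (k l)].
pose lo : set obs := [set y | y (k l) < cutoff l].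
have mk := measurable_coordinate (R := R) (k l).
have mhi : measurable hi.
  rewrite (_ : hi = [set y : obs | `]cutoff l, +oo[%classic (y (k l))]).
    exact: (measurable_preimage mk).
  by apply/seteqP; split => y; rewrite /hi/= in_itv/= andbT.
have mlo : measurable lo.
  rewrite (_ : lo = [set y : obs | `]-oo, cutoff l[%classic (y (k l))]).
    exact: (measurable_preimage mk).
  by apply/seteqP; split => y; rewrite /lo/= in_itv.
pose B := (hi `&` A) `|` (lo `&` ~` A).
have mB : measurable B.
  by apply: measurableU; apply: measurableI => //; exact: measurableC.
have u1 : `|unit_gap l| = 1 by apply: norm_normalized; rewrite -gap_neq0.
have ku : ip (k l) (unit_gap l) = delta l.
  by rewrite /unit_gap ipZr ip_norm -/(dist K g fmin l) expr2 mulrA mulVf// mul1r.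
have off0 : k l - ip (k l) (unit_gap l) *: unit_gap l = 0.
  by rewrite ku /unit_gap scalerA divff// scale1r subrr.
(* The gap is a multiple of the slicing direction, so on a slice the statistic involves only the
   noise at 0 and is almost surely determined by [x]. *)
have coord x : {ae P, forall w,
    slice ip eps (K (fmin l)) (unit_gap l) sigma x w (k l) - cutoff l = sigma * delta l * (x - z)}.
  apply: filterS (noise_zero eps_gaussian) => w w0.
  by rewrite /slice off0 w0 ku /cutoff; ring.
have mS C x : measurable C ->
    measurable [set w | C (slice ip eps (K (fmin l)) (unit_gap l) sigma x w)].
  by move=> mC; exact: measurable_preimage (measurable_slice1 ip eps _ _ _ x) mC.
have B0 : {ae mu, forall x, slice_accept l B x = 0%E}.
  have Nz : {ae mu, forall x : R, x != z}.
    exists [set z]; split => //; first by rewrite lebesgue_measure_set1.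
    by move=> x /= /negP; rewrite negbK => /eqP.
  apply: (@filterS2 _ _ (ae_filter_ringOfSetsType mu) _ _ _ _ Aae Nz) => x Ax xz.
  (* For [x > z] the statistic exceeds the cutoff, and the slice of [B] has the probability of that
     of [A], namely 0; for [x < z] it has the probability of the complement, whose slice is null
     too. *)
  have [zx|xz'] := ltP z x.
    rewrite -[RHS](_ : slice_accept l A x = 0%E); last first.
      by rewrite Ax indicE memNset//= in_itv/= leNgt zx.
    apply: ae_eq_measure; [exact: mS|exact: mS|].
    apply: filterS (coord x) => w cw.
    have hiw : hi (slice ip eps (K (fmin l)) (unit_gap l) sigma x w).
      by rewrite /hi/= -subr_gt0 cw mulr_gt0// subr_gt0.
    split => [[[]//|[low _]]|Aw]; last by left.
    by move: hiw low; rewrite /hi/lo/= => /ltW; rewrite leNgt => /negP.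
  have {xz xz'} xz : x < z by rewrite lt_neqAle xz.
  have A1 : slice_accept l A x = 1%E.
    by rewrite Ax indicE mem_set//= in_itv/= ltW.
  transitivity (P (~` [set w | A (slice ip eps (K (fmin l)) (unit_gap l) sigma x w)])).
    apply: ae_eq_measure; [exact: mS|by apply: measurableC; exact: mS|].
    apply: filterS (coord x) => w cw.
    have low : lo (slice ip eps (K (fmin l)) (unit_gap l) sigma x w).
      by rewrite /lo/= -subr_lt0 cw pmulr_rlt0// subr_lt0.
    split => [[[hiw _]|[]//]|Aw]; last by right.
    by move: hiw low; rewrite /hi/lo/= => /ltW; rewrite leNgt => /negP.
  by rewrite probability_setC;
    [rewrite -/(slice_prob _ _ _ _ _ A x) -/(slice_accept l A x) A1 subee|exact: mS].
have PB : P [set w | B (Y (fmin l) w)] = 0%E.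
  rewrite (law_fmin d0 mB).
  have mp : measurable_fun setT (slice_accept l B) by exact: measurable_slice_prob.
  have -> := integral_normal_prob 0 1 mp (fun x => measure_ge0 _ _).
  rewrite -[RHS](integral0 mu setT).
  apply: ae_eq_integral; [exact: measurableT| |exact: measurable_cst|].
    by apply: emeasurable_funM => //; apply/measurable_EFinP; exact: measurable_normal_pdf.
  by apply: (@filterS _ _ (ae_filter_ringOfSetsType mu) _ _ _ B0) => x -> _; rewrite mul0e.
have PBf := observe_absolutely_continuous (K f) mB PB.
exists [set w | B (Y f w)]; split => //.
  exact: measurable_preimage (measurable_observation f) mB.
move=> w /= bad; apply: contrapT => nB; apply: bad; split => [hiw Aw|low].
  by apply: nB; left.
by apply: contrapT => nA; apply: nB; right.
Qed.

(** * Inclusion probabilities, coverage and the tie-breaking event *)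

Lemma expected_lengthE (C : obs -> set R) :
  measurable [set yl : obs * R | C yl.1 yl.2] ->
  expected_length P Y g C = (\int[mu]_l P [set w | C (Y g w) l])%E.
Proof.
move=> mC.
pose S := [set p : T * R | C (Y g p.1) p.2].
have mS : measurable S.
  apply: (@measurable_preimage _ _ (T * R)%type (obs * R)%type (fun p => (Y g p.1, p.2))) mC.
  apply: measurable_fun_pair; last exact: measurable_snd.
  exact: (measurableT_comp (measurable_observation g) measurable_fst).
have mS' : measurable (S : set (T * measurableTypeR R)) by exact: mS.
have := @fubini_tonelli _ _ T (measurableTypeR R) R P mu (fun p => (\1_S p)%:E).
rewrite /expected_length => fub.
transitivity (\int[P]_w \int[mu]_l (\1_S (w, l))%:E)%E.
  apply: eq_integral => w _.
  rewrite -[LHS](_ : mu (xsection S w) = _); last first.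
    by congr (mu _); apply/seteqP; split => l; rewrite /xsection/= inE.
  have mw : measurable (xsection S w) by exact: (measurable_xsection w mS').
  rewrite -(setIT (xsection S w)) -integral_indic//.
  by apply: eq_integral => l _; rewrite !indicE mem_xsection.
rewrite fub; last 2 first.
- by apply/measurable_EFinP; exact: measurable_indic.
- by move=> p; rewrite lee_fin.
apply: eq_integral => l _.
rewrite -[RHS](_ : P (ysection S l) = _); last first.
  by congr (P _); apply/seteqP; split => w; rewrite /ysection/= inE.
have mw : measurable (ysection S l) by exact: (measurable_ysection l mS').
rewrite -(setIT (ysection S l)) -integral_indic//.
by apply: eq_integral => w _; rewrite !indicE mem_ysection.
Qed.

Lemma confidence_coverage (C : obs -> set R) f : confidence_set P Y F L alpha C -> F f ->
  ((1 - alpha)%:E <= P [set w | C (Y f w) (L f)])%E.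
Proof.
move=> [_ h] Ff; apply: (le_trans h); apply: ereal_inf_lbound.
by exists f.
Qed.

Lemma Y_fmin0 l : delta l = 0 -> Y (fmin l) = Y g.
Proof.
move=> /eqP; rewrite normr_eq0 => /eqP k0.
by apply: observation_eq; rewrite (gap_sub K g fmin l) k0 subr0.
Qed.

Lemma accept_prob_le (C : obs -> set R) l : confidence_set P Y F L alpha C ->
  (accept_prob l <= P [set w | C (Y g w) l])%E.
Proof.
move=> hC; have := confidence_coverage hC (Ffmin fminP l); rewrite (Lfmin fminP l) => cov.
have [d0|d0] := eqVneq (delta l) 0; first by rewrite accept_prob0// -(Y_fmin0 d0).
have [mC _] := hC.
by have [] := power_bound d0 (ysection_measurable l mC) cov.
Qed.

(** The tie-breaking event is that one standardized nonzero statistic, centered at its mean under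
    [g], leaves the interval from [- t] to [t] of probability [alpha]. Another mean only lowers the
    probability of the interval. *)
Lemma tie_exists : exists tie : set obs,
  [/\ measurable tie, forall f, ((1 - alpha)%:E <= P [set w | tie (Y f w)])%E &
      (P [set w | tie (Y g w)] = (1 - alpha)%:E \/ forall l, delta l = 0)].
Proof.
have [[l0 d0]|none] := pselect (exists l, delta l != 0); last first.
  (* If all gaps vanish there is no statistic to randomize with, and the whole line is accepted. *)
  exists setT; split=> [//|f|].
    by rewrite probability_setT lee_fin lerBlDl lerDr ltW.
  right => l; apply: contrapT => /eqP d0; apply: none; by exists l.
set h := k l0; have h0 : h != 0 by rewrite -gap_neq0.
have nh : 0 < `|h| by rewrite normr_gt0.
have [t t0 tE] : exists2 t : R, 0 <= t & Phi `[(- t)%R, t] = alpha%:E.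
  by apply: normal_prob_centered_itv_exists; rewrite alpha_gt0.
pose I : set R := `[(- t)%R, t]%classic.
have mI : measurable I by exact: measurable_itv.
pose tie : set obs := [set y | ~ I ((y h - ip (K g) h) / (sigma * `|h|))].
have mtie : measurable tie.
  apply: (@measurable_preimage _ _ obs R (fun y => (y h - ip (K g) h) / (sigma * `|h|)) (~` I)).
    apply: measurable_funM => //; apply: measurable_funB => //.
    exact: measurable_coordinate.
  exact: measurableC.
pose m f := (ip (K f) h - ip (K g) h) / (sigma * `|h|).
have tieE f : P [set w | tie (Y f w)] = (1 - normal_prob (m f) 1 I)%E.
  have mJ : measurable [set w | I (m f + `|h|^-1 * eps h w)].
    apply: (@measurable_preimage _ _ _ _ (fun w => m f + `|h|^-1 * eps h w)) mI.
    by apply: measurable_funD => //; exact: measurable_funM.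
  have -> : [set w | tie (Y f w)] = ~` [set w | I (m f + `|h|^-1 * eps h w)].
    apply/seteqP; split => w; rewrite /tie /= /observation;
      rewrite (_ : (_ - _) / _ = m f + `|h|^-1 * eps h w)//;
      by rewrite /m; field; rewrite gt_eqF//= gt_eqF.
  rewrite probability_setC// (noise_affine_law eps_gaussian _ _ h0 mI).
  rewrite (mulVf (lt0r_neq0 nh)) -[in RHS](add0r (m f)) -(normal_prob_translate 0 _ (oner_neq0 _) mI).
  by congr (1 - normal_prob _ _ _)%E; apply/funext => x /=; rewrite mul1r addrC.
exists tie; split=> [//|f|].
  rewrite tieE EFinB leeB// -tE; exact: normal_prob_centered_itv.
by left; rewrite tieE /m subrr mul0r tE EFinB.
Qed.

(** * Coverage, inversion and expected length of the optimal set *)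

Lemma optimal_set0 tie l y : delta l = 0 -> optimal_set tie y l = tie y.
Proof. by move=> d0; rewrite /optimal_set /= d0 eqxx. Qed.

Lemma optimal_confidence tie : measurable tie ->
  (forall f, ((1 - alpha)%:E <= P [set w | tie (Y f w)])%E) ->
  confidence_set P Y F L alpha (optimal_set tie).
Proof.
move=> mtie tieP; split; first exact: measurable_optimal_set.
apply: le_ereal_inf_tmp => _ [f Ff <-]; rewrite /coverage.
have [d0|d0] := eqVneq (delta (L f)) 0.
  rewrite (_ : [set w | _] = [set w | tie (Y f w)])//.
  by apply/funext => w /=; rewrite optimal_set0.
by rewrite optimal_set_prob//; exact: accept_F.
Qed.

(** The cutoff is 0 and the statistic is almost surely 0, so neither strict inequality occurs. *)
Lemma inverts_gap0 l f (Q1 Q2 : T -> Prop) : delta l = 0 ->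
  {ae P, forall w, (cutoff l < test_statistic K g (fmin l) (Y f w) -> Q1 w) /\
    (test_statistic K g (fmin l) (Y f w) < cutoff l -> Q2 w)}.
Proof.
move=> d0; have /eqP k0 : k l == 0 by rewrite -normr_eq0; apply/eqP.
apply: filterS (noise_zero eps_gaussian) => w w0.
rewrite statisticE /cutoff d0 k0 w0 !linear0r ?mulr0 ?mul0r ?addr0 ltxx.
by split.
Qed.

Lemma optimal_inverts tie l :
  inverts_test_at P Y F K alpha g (fmin l) (optimal_set tie) l.
Proof.
rewrite /inverts_test_at critical_valueE => f Ff.
have [d0|d0] := eqVneq (delta l) 0; first exact: inverts_gap0.
apply: filterS (optimal_set_ae tie (K f) d0) => w.
rewrite statisticE /observe => e; split => [lt /e|/ltW /e//].
by rewrite leNgt lt.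
Qed.

Lemma optimal_length tie : measurable tie ->
  (forall f, ((1 - alpha)%:E <= P [set w | tie (Y f w)])%E) ->
  (P [set w | tie (Y g w)] = (1 - alpha)%:E \/ forall l, delta l = 0) ->
  expected_length P Y g (optimal_set tie) = (\int[mu]_l accept_prob l)%E.
Proof.
move=> mtie tieP tieg; rewrite expected_lengthE; last exact: measurable_optimal_set.
case: tieg => [tieg|all0].
  apply: eq_integral => l _; have [d0|d0] := eqVneq (delta l) 0.
    rewrite accept_prob0// -tieg; congr (P _).
    by apply/funext => w /=; rewrite optimal_set0.
  by rewrite optimal_set_prob// accept_g.
(* When all gaps vanish, both integrands are positive constants and both integrals are infinite,
   even if the constants differ. *)
have muT : mu setT = +oo%E by rewrite -set_itvNyy lebesgue_measure_itv.
transitivity (\int[mu]_(l in setT) (P [set w | tie (Y g w)]))%E.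
  by apply: eq_integral => l _; congr (P _); apply/funext => w /=; rewrite optimal_set0.
transitivity (\int[mu]_(l in setT) (1 - alpha)%:E)%E; last first.
  by apply: eq_integral => l _; rewrite accept_prob0.
have a0 : (0 < (1 - alpha)%:E :> \bar R)%E by rewrite lte_fin subr_gt0.
have intT (c : \bar R) : (0 < c)%E -> (\int[mu]_(l in setT) c = +oo)%E.
  move=> c0; transitivity (c * mu setT)%E; first exact: integral_cst.
  by rewrite muT gt0_muley.
by rewrite !intT// (lt_le_trans a0 (tieP g)).
Qed.

(** Tonelli for the set [S]: its section at [l] has probability [accept_prob l], and its section at
    [w] is a sublevel set of [delta], measured by the two moduli. The factor [1 - alpha] cancels the
    normalization of the conditional expectation. *)
Lemma length_formula d' (T' : measurableType d') (Q : probability T' R) (Z : {RV Q >-> R}) :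
  is_normal Z 0 1 ->
  (\int[mu]_l accept_prob l = (1 - alpha)%:E *
     cond_expectation Q
       (fun w => (modulus K L (sigma * (z - Z w))%R F [set g]
                  + modulus K L (sigma * (z - Z w))%R [set g] F)%E)
       [set w | (Z w <= z)%R])%E.
Proof.
move=> Z_normal; set A := [set w | _].
have Zlaw (x : R) : Q [set w | Z w <= x] = Phi `]-oo, x].
  have := Z_normal `]-oo, x]%classic (measurable_itv _); rewrite oner_eq0 => <-.
  by congr (Q _); apply/seteqP; split => w /=; rewrite in_itv.
have QA : Q A = (1 - alpha)%:E by rewrite Zlaw normal_quantileE.
have mA : measurable A.
  rewrite (_ : A = Z @^-1` `]-oo, z]%classic); first exact: measurable_funPTI.
  by apply/seteqP; split => w /=; rewrite in_itv.
pose S := [set p : T' * R | delta p.2 <= sigma * (z - Z p.1)].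
have mS : measurable S.
  rewrite (_ : S = [set p | `]-oo, 0]%classic (delta p.2 - sigma * (z - Z p.1))]); last first.
    by apply/seteqP; split => p /=; rewrite in_itv/= subr_le0.
  apply: (@measurable_preimage _ _ (T' * R)%type R
    (fun p => delta p.2 - sigma * (z - Z p.1))); last exact: measurable_itv.
  apply: measurable_funB.
    exact: (measurableT_comp (measurable_dist F_convex fminP) measurable_snd).
  apply: measurable_funM => //; apply: measurable_funB => //.
  exact: measurableT_comp.
have mS' : measurable (S : set (T' * measurableTypeR R)) by exact: mS.
pose M w := mu (xsection S w).
have ME w : M w = mu [set l | delta l <= sigma * (z - Z w)].
  by congr (mu _); apply/seteqP; split => l; rewrite /xsection/= inE.
have mM : measurable_fun setT M by exact: (measurable_fun_xsection mu mS').
have M0 w : (0 <= M w)%E by exact: measure_ge0.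
have IM : (\int[mu]_l accept_prob l = \int[Q]_w M w)%E.
  transitivity (\int[mu]_l \int[Q]_w (\1_S (w, l))%:E)%E.
    apply: eq_integral => l _.
    have ml : measurable (ysection S l) by exact: (measurable_ysection l mS').
    transitivity (Q (ysection S l)).
      have eqv w : (Z w <= z - delta l / sigma) = (delta l <= sigma * (z - Z w)).
        by rewrite (mulrC sigma) -ler_pdivrMr// !lerBrDr addrC.
      rewrite /accept_prob -Zlaw; congr (Q _).
      by apply/seteqP; split => w; rewrite /ysection/= inE /S /= eqv.
    rewrite -(setIT (ysection S l)) -integral_indic//.
    by apply: eq_integral => w _; rewrite !indicE mem_ysection.
  rewrite -(@fubini_tonelli _ _ T' (measurableTypeR R) R Q mu (fun p => (\1_S p)%:E)); last 2 first.
  - by apply/measurable_EFinP; exact: measurable_indic.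
  - by move=> p; rewrite lee_fin.
  apply: eq_integral => w _.
  have mw : measurable (xsection S w) by exact: (measurable_xsection w mS').
  rewrite /M -(setIT (xsection S w)) -integral_indic//.
  by apply: eq_integral => l _; rewrite !indicE mem_xsection.
(* Where [Z w > z] the bound on [delta] is negative and the sublevel set is empty. *)
have IA : (\int[Q]_w M w = \int[Q]_(w in A) M w)%E.
  rewrite [RHS]integral_mkcond; apply: eq_integral => w _.
  rewrite patchE; case: ifPn => // /negP; rewrite inE /A/= => /negP; rewrite -ltNge => zw.
  rewrite ME (_ : [set l | _] = set0) ?measure0//.
  rewrite -subset0 => l /=; rewrite leNgt => /negP; apply.
  by rewrite (lt_le_trans _ (dist_ge0 _ _ _ _))// pmulr_rlt0// subr_lt0.
rewrite /cond_expectation QA /=.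
rewrite (eq_integral M); last first.
  move=> w; rewrite inE /A/= => wz; rewrite ME (sublevel_measure F_convex Fg fminP)//.
  by rewrite mulr_ge0// ?subr_ge0// ltW.
rewrite IM IA muleCA -EFinM divff ?mule1//.
by rewrite gt_eqF// subr_gt0.
Qed.

(** * Minimal expected length is equivalent to inversion of the tests *)

Lemma measurable_accept_prob : measurable_fun setT accept_prob.
Proof.
apply: (measurableT_comp (@measurable_normal_cdf R)).
apply: measurable_funB => //; apply: measurable_funM => //.
exact: (measurable_dist F_convex fminP).
Qed.

Lemma measurable_inclusion_prob (C : obs -> set R) :
  measurable [set yl : obs * R | C yl.1 yl.2] ->
  measurable_fun setT (fun l => P [set w | C (Y g w) l]).
Proof.
move=> mC; pose S := [set p : T * R | C (Y g p.1) p.2].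
have mS : measurable S.
  apply: (@measurable_preimage _ _ (T * R)%type (obs * R)%type (fun p => (Y g p.1, p.2))) mC.
  apply: measurable_fun_pair; last exact: measurable_snd.
  exact: (measurableT_comp (measurable_observation g) measurable_fst).
have := measurable_fun_ysection P mS.
rewrite (_ : _ \o _ = fun l => P [set w | C (Y g w) l])//.
apply/funext => l /=; congr (P _).
by apply/seteqP; split => w /=; rewrite /ysection/= inE.
Qed.

Lemma expected_length_ge (C : obs -> set R) : confidence_set P Y F L alpha C ->
  (\int[mu]_l accept_prob l <= expected_length P Y g C)%E.
Proof.
move=> hC; have [mC _] := hC; rewrite expected_lengthE//.
apply: ge0_le_integral => //.
- exact: measurable_accept_prob.
- exact: measurable_inclusion_prob.
- by move=> l _; exact: accept_prob_le.
Qed.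

(** With a nonzero gap, inversion under [g] determines inclusion up to a null tie. With a zero gap
    the test says nothing, but [g] and [fmin l] give the same observation, and exact coverage
    settles the value. *)
Lemma inclusion_prob_of_inverts (C : obs -> set R) l :
  measurable [set yl : obs * R | C yl.1 yl.2] ->
  inverts_test_at P Y F K alpha g (fmin l) C l ->
  coverage P Y C (fmin l) l = (1 - alpha)%:E ->
  P [set w | C (Y g w) l] = accept_prob l.
Proof.
move=> mC; rewrite /inverts_test_at critical_valueE => inv cov.
have [d0|d0] := eqVneq (delta l) 0.
  by rewrite accept_prob0// -cov /coverage Y_fmin0.
rewrite -accept_g//; apply: ae_eq_measure.
- exact: (measurable_preimage (measurable_observation g) (ysection_measurable l mC)).
- exact: (measurable_preimage (measurable_observation g) (accept_measurable l)).
apply: filterS2 (inv g Fg) (observe_ne (K g) (cutoff l) d0) => w /=.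
rewrite statisticE => -[hi lo] ne; split => [Cw|].
  by rewrite leNgt; apply/negP => /hi.
by rewrite le_eqVlt (negbTE ne) => /lo.
Qed.

Lemma minimizes_of_inverts (C : obs -> set R) : confidence_set P Y F L alpha C ->
  {ae mu, forall l : R, inverts_test_at P Y F K alpha g (fmin l) C l /\
    coverage P Y C (fmin l) l = (1 - alpha)%:E} ->
  minimizes_expected_length P Y F L alpha g C.
Proof.
move=> hC inv; split => // C' hC'; have [mC _] := hC.
apply: le_trans (expected_length_ge hC'); rewrite expected_lengthE//.
rewrite le_eqVlt; apply/orP; left; apply/eqP; apply: ae_eq_integral.
- exact: measurableT.
- exact: measurable_inclusion_prob.
- exact: measurable_accept_prob.
apply: (@filterS _ _ (ae_filter_ringOfSetsType mu) _ _ _ inv) => l [il cl] _.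
exact: inclusion_prob_of_inverts.
Qed.

(** Inclusion probability dominates [accept_prob] pointwise and has the same finite integral, so the
    two agree for almost every [l]; the equality case of Neyman-Pearson then applies. Finiteness is
    what allows the integrals to be subtracted. *)
Lemma inverts_of_minimizes (C : obs -> set R) : confidence_set P Y F L alpha C ->
  (expected_length P Y g C < +oo)%E ->
  expected_length P Y g C = (\int[mu]_l accept_prob l)%E ->
  {ae mu, forall l : R, inverts_test_at P Y F K alpha g (fmin l) C l /\
    coverage P Y C (fmin l) l = (1 - alpha)%:E}.
Proof.
move=> hC fin eqC; have [mC _] := hC.
pose a l := P [set w | C (Y g w) l].
have ma : measurable_fun setT a by exact: measurable_inclusion_prob.
have mb := measurable_accept_prob.
have ai : mu.-integrable setT a.
  apply/integrableP; split => //.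
  apply: le_lt_trans fin; rewrite expected_lengthE// le_eqVlt; apply/orP; left.
  by apply/eqP; apply: eq_integral => l _; rewrite gee0_abs.
have bi : mu.-integrable setT accept_prob.
  apply/integrableP; split => //.
  apply: le_lt_trans fin; rewrite eqC le_eqVlt; apply/orP; left.
  by apply/eqP; apply: eq_integral => l _; rewrite gee0_abs.
have mCl l : measurable [set w | C (Y g w) l].
  exact: (measurable_preimage (measurable_observation g) (ysection_measurable l mC)).
have afin l : a l \is a fin_num by exact: fin_num_measure.
have bfin l : accept_prob l \is a fin_num by apply: fin_num_measure; exact: measurable_itv.
have ab l : (0 <= a l - accept_prob l)%E.
  by rewrite sube_ge0 ?accept_prob_le// bfin.
have iab : (\int[mu]_l `|a l - accept_prob l| = 0)%E.
  transitivity (\int[mu]_l (a l - accept_prob l))%E.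
    by apply: eq_integral => l _; rewrite gee0_abs.
  rewrite integralB// -eqC expected_lengthE// subee// -expected_lengthE//.
  by rewrite ge0_fin_numE// integral_ge0.
have mab : measurable_fun setT (fun l => a l - accept_prob l)%E by exact: emeasurable_funB.
have abz := (ae_eq_integral_abs mu measurableT mab).1 iab.
apply: (@filterS _ _ (ae_filter_ringOfSetsType mu) _ _ _ abz) => l /(_ I) /eqP.
rewrite sube_eq// ?fin_num_adde_defl// add0e => /eqP {}abz.
have cov := confidence_coverage hC (Ffmin fminP l); rewrite (Lfmin fminP l) in cov.
rewrite /inverts_test_at critical_valueE.
have [d0|d0] := eqVneq (delta l) 0.
  split; first by move=> f Ff; exact: inverts_gap0.
  by rewrite /coverage Y_fmin0// -(accept_prob0 d0).
have [_ /(_ abz)[covE slices]] := power_bound d0 (ysection_measurable l mC) cov.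
split => // f Ff; exact: inverts_of_slices d0 (ysection_measurable l mC) slices.
Qed.

End constrained_gaussian_model.

Theorem theorem3p2 (R : realType) (V : lmodType R)
    (H : completeNormedModType R) (ip : {dot H for idfun})
    (ip_norm : forall h : H, ip h h = `|h| ^+ 2)
    (F : set V) (F_convex : convex_set F)
    (K : {linear V -> H}) (L : {scalar V})
    (sigma : R) (sigma_gt0 : 0 < sigma)
    (d : measure_display) (T : measurableType d) (P : probability T R)
    (eps : H -> {RV P >-> R}) (eps_gaussian : standard_gaussian eps)
    (alpha : R) (alpha_gt0 : 0 < alpha) (alpha_lt1 : alpha < 1)
    (g : V) (Fg : F g)
    (fmin : R -> V)
    (fminP : forall l : R, is_constrained_minimizer F K L g l (fmin l))
    (d' : measure_display) (T' : measurableType d') (Q : probability T' R)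
    (Z : {RV Q >-> R}) (Z_normal : is_normal Z 0 1) :
  let Y := observation ip K sigma eps in
  let z := normal_quantile (1 - alpha) in
  (exists Cg : obs_space H R -> set R,
    [/\ minimizes_expected_length P Y F L alpha g Cg,
        (forall l : R, inverts_test_at P Y F K alpha g (fmin l) Cg l) &
        expected_length P Y g Cg =
        ((1 - alpha)%:E *
         cond_expectation Q
           (fun w => (modulus K L (sigma * (z - Z w))%R F [set g]
                      + modulus K L (sigma * (z - Z w))%R [set g] F)%E)
           [set w | (Z w <= z)%R])%E]) /\
  (forall C : obs_space H R -> set R, confidence_set P Y F L alpha C ->
    ({ae lebesgue_measure, forall l : R,
        inverts_test_at P Y F K alpha g (fmin l) C l /\
        coverage P Y C (fmin l) l = (1 - alpha)%:E} ->
      minimizes_expected_length P Y F L alpha g C) /\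
    (minimizes_expected_length P Y F L alpha g C ->
      (expected_length P Y g C < +oo)%E ->
      {ae lebesgue_measure, forall l : R,
        inverts_test_at P Y F K alpha g (fmin l) C l /\
        coverage P Y C (fmin l) l = (1 - alpha)%:E})).
Proof.
move=> Y z.
have [tie [mtie tieP tieg]] :=
  tie_exists ip K g fmin sigma_gt0 eps_gaussian alpha_gt0 alpha_lt1.
pose Cg := optimal_set ip K g fmin sigma alpha tie.
have Cg_conf : confidence_set P Y F L alpha Cg.
  exact: (optimal_confidence ip_norm F_convex fminP sigma_gt0 eps_gaussian
    alpha_gt0 alpha_lt1 mtie tieP).
have Cg_length := optimal_length ip_norm F_convex fminP sigma_gt0 eps_gaussian
  alpha_gt0 alpha_lt1 mtie tieP tieg.
have ge C : confidence_set P Y F L alpha C ->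
    (expected_length P Y g Cg <= expected_length P Y g C)%E.
  move=> hC; rewrite Cg_length.
  exact: (expected_length_ge ip_norm F_convex fminP sigma_gt0 eps_gaussian
    alpha_gt0 alpha_lt1 hC).
split.
  exists Cg; split => //.
    exact: (optimal_inverts ip_norm F_convex fminP sigma_gt0 eps_gaussian
      alpha_gt0 alpha_lt1).
  rewrite Cg_length.
  exact: (length_formula F_convex Fg fminP sigma_gt0 alpha_gt0 alpha_lt1 Z_normal).
move=> C hC; split.
  exact: (minimizes_of_inverts ip_norm F_convex Fg fminP sigma_gt0 eps_gaussian
    alpha_gt0 alpha_lt1 hC).
move=> [_ Cmin] Cfin.
apply: (inverts_of_minimizes ip_norm F_convex fminP sigma_gt0 eps_gaussian
  alpha_gt0 alpha_lt1 hC Cfin).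
(* The set [Cg] attains the lower bound, so a minimizing [C] has exactly that expected length. *)
by rewrite -Cg_length; apply/eqP; rewrite eq_le Cmin//= ge.
Qed.
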